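(* Let $\Omega\in\mathbf{R}$. For every $n=(n_1,n_2,n_3)$, the quasiperiodic ($\mathbf{T}^2$ in time) solenoidal fields $$\mathbf{V}(t,y)=\frac{\Omega}{2}\mathbf{e}_3\times y+\exp\Big(\frac{\Omega}{2}\mathbf{J}t\Big)\,\mathbf{\Phi}_n\Big(\exp\big(-\tfrac{\Omega}{2}\mathbf{J}t\big)y\Big)\,\exp\Big(\pm i\frac{n_3}{|\lambda_n|}\alpha\Omega t\Big)$$ are exact solutions of the full 3D nonlinear incompressible Euler equations $$\partial_t\mathbf{V}+(\mathbf{V}\cdot\nabla)\mathbf{V}=-\nabla p,\qquad \nabla\cdot\mathbf{V}=0$$ in the cylinder $\mathbf{C}$, with $2\pi/\alpha$-periodic boundary conditions in $y_3$ and $\mathbf{V}\cdot\mathbf{N}=0$ on the lateral boundary $\Gamma$.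
   Context: Domain: $\mathbf{C}=\{(y_1,y_2,y_3): 0<y_3<2\pi/\alpha,\ y_1^2+y_2^2<R^2\}$, with $R=1$, height $h$, $\alpha=2\pi/h$; $\Gamma$ is its lateral boundary $y_1^2+y_2^2=R^2$, with normal $\mathbf{N}$. The vector $\mathbf{e}_3$ is the vertical unit vector and $$\mathbf{J}=\begin{pmatrix}0&-1&0\\1&0&0\\0&0&0\end{pmatrix},\qquad e^{\Omega\mathbf{J}t/2}=\begin{pmatrix}\cos(\Omega t/2)&-\sin(\Omega t/2)&0\\ \sin(\Omega t/2)&\cos(\Omega t/2)&0\\0&0&1\end{pmatrix}.$$ For $n_3\neq0$, $\mathbf{\Phi}_n=\mathbf{\Phi}_n^{\pm}$ denotes a (complex-valued) eigenfunction of curl, $curl\,\mathbf{\Phi}_n^\pm=\pm|\lambda_n|\mathbf{\Phi}_n^\pm$, divergence free, with $\mathbf{\Phi}_n\cdot\mathbf{N}=0$ on $\Gamma$, $2\pi/\alpha$-periodic in $y_3$, of the form (in cylindrical coordinates $(r,\theta,z)$) $\big(\Phi_{r,n}(r),\Phi_{\theta,n}(r),\Phi_{z,n}(r)\big)e^{in_2\theta}e^{i\alpha n_3 z}$, with $n_2\in\mathbf{Z}$, $n_3\in\mathbf{Z}\setminus\{0\}$, and $n_1$ indexing the radial eigenvalue problem. The sign in the time exponential is the sign of the curl eigenvalue of $\mathbf{\Phi}_n^{\pm}$. For $n_3=0$, $\mathbf{\Phi}_n$ is the field with horizontal projection $curl(\phi_n\mathbf{e}_3)$ and vertical component $\phi_n\mathbf{e}_3$,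 where $\phi_n=\phi_n(r,\theta)$, $-\Delta\phi_n=\mu_n\phi_n$ and $\phi_n=0$ on $\Gamma$; in this case the time exponential equals $1$. For complex-valued fields, $(\mathbf{V}\cdot\nabla)\mathbf{V}$ is the bilinear expression (no complex conjugation). *)

(* Defs.v *)
From Stdlib Require Import Reals ZArith.
From Coquelicot Require Import Coquelicot.
Open Scope R_scope.

Definition point : Type := (R * R * R)%type.
Definition cvec : Type := (C * C * C)%type.

Definition R3 : NormedModule R_AbsRing :=
  prod_NormedModule _ (prod_NormedModule _ R_NormedModule R_NormedModule)
    R_NormedModule.

Definition x1 (y : point) : R := fst (fst y).
Definition x2 (y : point) : R := snd (fst y).
Definition x3 (y : point) : R := snd y.

Definition c1 (v : cvec) : C := fst (fst v).
Definition c2 (v : cvec) : C := snd (fst v).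
Definition c3 (v : cvec) : C := snd v.

Definition cvec_of_point (y : point) : cvec :=
  (RtoC (x1 y), RtoC (x2 y), RtoC (x3 y)).

Definition vzero : cvec := (RtoC 0, RtoC 0, RtoC 0).

Definition vadd (u v : cvec) : cvec :=
  ((c1 u + c1 v)%C, (c2 u + c2 v)%C, (c3 u + c3 v)%C).

Definition vopp (v : cvec) : cvec := ((- c1 v)%C, (- c2 v)%C, (- c3 v)%C).

Definition vscal (a : C) (v : cvec) : cvec :=
  ((a * c1 v)%C, (a * c2 v)%C, (a * c3 v)%C).

Definition cross (u v : cvec) : cvec :=
  ((c2 u * c3 v - c3 u * c2 v)%C,
   (c3 u * c1 v - c1 u * c3 v)%C,
   (c1 u * c2 v - c2 u * c1 v)%C).

(* Bilinear, without complex conjugation. *)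
Definition vdot (u v : cvec) : C :=
  (c1 u * c1 v + c2 u * c2 v + c3 u * c3 v)%C.

Definition e3 : cvec := (RtoC 0, RtoC 0, RtoC 1).

(* e^{i x} for real x *)
Definition cis (x : R) : C := (cos x, sin x).

(* The matrix exp(a J), acting on real points and on complex vectors. *)
Definition rot_point (a : R) (y : point) : point :=
  (cos a * x1 y - sin a * x2 y, sin a * x1 y + cos a * x2 y, x3 y).

Definition rot_vec (a : R) (v : cvec) : cvec :=
  ((RtoC (cos a) * c1 v - RtoC (sin a) * c2 v)%C,
   (RtoC (sin a) * c1 v + RtoC (cos a) * c2 v)%C,
   c3 v).

(* Derivative of a complex-valued function of a real variable.  It is total,
   and takes junk values where the function is not differentiable; every use
   below comes with a C^1 assumption or conclusion. *)
Definition CDerive (f : R -> C) (x : R) : C :=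
  (Derive (fun s => Re (f s)) x, Derive (fun s => Im (f s)) x).

Definition d1 (f : point -> C) (y : point) : C :=
  CDerive (fun s => f (s, x2 y, x3 y)) (x1 y).
Definition d2 (f : point -> C) (y : point) : C :=
  CDerive (fun s => f (x1 y, s, x3 y)) (x2 y).
Definition d3 (f : point -> C) (y : point) : C :=
  CDerive (fun s => f (x1 y, x2 y, s)) (x3 y).

Definition grad (f : point -> C) (y : point) : cvec := (d1 f y, d2 f y, d3 f y).

Definition laplacian (f : point -> C) (y : point) : C :=
  (d1 (d1 f) y + d2 (d2 f) y + d3 (d3 f) y)%C.

Definition div (F : point -> cvec) (y : point) : C :=
  (d1 (fun z => c1 (F z)) y + d2 (fun z => c2 (F z)) y
   + d3 (fun z => c3 (F z)) y)%C.

Definition curl (F : point -> cvec) (y : point) : cvec :=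
  ((d2 (fun z => c3 (F z)) y - d3 (fun z => c2 (F z)) y)%C,
   (d3 (fun z => c1 (F z)) y - d1 (fun z => c3 (F z)) y)%C,
   (d1 (fun z => c2 (F z)) y - d2 (fun z => c1 (F z)) y)%C).

(* (F . nabla) G *)
Definition advect (F G : point -> cvec) (y : point) : cvec :=
  (vdot (F y) (grad (fun z => c1 (G z)) y),
   vdot (F y) (grad (fun z => c2 (G z)) y),
   vdot (F y) (grad (fun z => c3 (G z)) y)).

Definition dt (V : R -> point -> cvec) (t : R) (y : point) : cvec :=
  (CDerive (fun s => c1 (V s y)) t,
   CDerive (fun s => c2 (V s y)) t,
   CDerive (fun s => c3 (V s y)) t).

(* C^1 on an open set D: Frechet differentiable over the reals, with
   continuous differential. *)
Definition C1_on {U : NormedModule R_AbsRing} (D : U -> Prop) (f : U -> C) : Prop :=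
  exists df : U -> U -> C, forall x : U, D x ->
    filterdiff (V := C_R_NormedModule) f (locally x) (df x) /\
    forall v : U, continuous (U := C_R_NormedModule) (fun x' => df x' v) x.

Definition C1_vec_on {U : NormedModule R_AbsRing} (D : U -> Prop)
    (F : U -> cvec) : Prop :=
  C1_on D (fun x => c1 (F x)) /\ C1_on D (fun x => c2 (F x)) /\
  C1_on D (fun x => c3 (F x)).

Definition C2_on (D : point -> Prop) (f : point -> C) : Prop :=
  C1_on (U := R3) D f /\ C1_on (U := R3) D (d1 f) /\
  C1_on (U := R3) D (d2 f) /\ C1_on (U := R3) D (d3 f).

Definition radius : R := 1.
Definition alpha (h : R) : R := 2 * PI / h.

Definition cylinder (h : R) (y : point) : Prop :=
  0 < x3 y < 2 * PI / alpha h /\ x1 y ^ 2 + x2 y ^ 2 < radius ^ 2.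

Definition lateral (y : point) : Prop := x1 y ^ 2 + x2 y ^ 2 = radius ^ 2.

Definition normal (y : point) : cvec :=
  (RtoC (x1 y / radius), RtoC (x2 y / radius), RtoC 0).

(* The cylinder continued periodically in y3, with its lateral boundary. *)
Definition closed_tube (y : point) : Prop := x1 y ^ 2 + x2 y ^ 2 <= radius ^ 2.

(* Regularity up to the lateral boundary means regularity on some [tube rho]
   with [radius < rho]. *)
Definition tube (rho : R) (y : point) : Prop := x1 y ^ 2 + x2 y ^ 2 < rho ^ 2.

Definition periodic {T : Type} (h : R) (F : point -> T) : Prop :=
  forall y, closed_tube y -> F (x1 y, x2 y, x3 y + 2 * PI / alpha h) = F y.

Definition tangential (F : point -> cvec) : Prop :=
  forall y, lateral y -> vdot (F y) (normal y) = RtoC 0.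

Definition sgn (pm : bool) : R := if pm then 1 else -1.

(* The cylindrical components of F are
   (Fr r, Ft r, Fz r) e^{i n2 theta} e^{i alpha n3 z}. *)
Definition separated (h : R) (n2 n3 : Z) (F : point -> cvec) : Prop :=
  exists Fr Ft Fz : R -> C, forall r theta z, 0 < r <= radius ->
    F (r * cos theta, r * sin theta, z) =
    vscal (cis (IZR n2 * theta) * cis (alpha h * IZR n3 * z))%C
      ((Fr r * RtoC (cos theta) - Ft r * RtoC (sin theta))%C,
       (Fr r * RtoC (sin theta) + Ft r * RtoC (cos theta))%C,
       Fz r).

(* Eigenfunctions Phi_n^{+-} of curl, n3 <> 0, with eigenvalue
   [sgn pm * |lam|]. *)
Definition curl_mode (h : R) (pm : bool) (n2 n3 : Z) (lam : R)
    (Phi : point -> cvec) : Prop :=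
  lam <> 0 /\
  (exists rho, radius < rho /\ C1_vec_on (U := R3) (tube rho) Phi) /\
  (exists y, cylinder h y /\ Phi y <> vzero) /\
  (forall y, cylinder h y ->
     curl Phi y = vscal (RtoC (sgn pm * Rabs lam)) (Phi y)) /\
  (forall y, cylinder h y -> div Phi y = RtoC 0) /\
  tangential Phi /\
  periodic h Phi /\
  separated h n2 n3 Phi.

(* Modes with n3 = 0, built on a Dirichlet eigenfunction phi of the disk. *)
Definition planar_mode (h : R) (Phi : point -> cvec) : Prop :=
  exists (phi : R * R -> C) (mu : R),
    let f := fun y : point => phi (x1 y, x2 y) in
    (exists rho, radius < rho /\ C2_on (tube rho) f) /\
    (exists y, cylinder h y /\ f y <> RtoC 0) /\
    (forall y, cylinder h y -> (- laplacian f y)%C = (RtoC mu * f y)%C) /\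
    (forall y, lateral y -> f y = RtoC 0) /\
    (forall y, Phi y = vadd (curl (fun z => vscal (f z) e3) y) (vscal (f y) e3)).

(* [(lam, Phi)] is (lambda_n, Phi_n^{+-}) for some n = (n1, n2, n3).  The index
   n1 only enumerates the radial eigenpairs for given n2, n3, so quantifying
   over [(lam, Phi)] covers every n1.  When n3 = 0, [lam] and [pm] play no
   role. *)
Definition mode (h : R) (pm : bool) (n2 n3 : Z) (lam : R)
    (Phi : point -> cvec) : Prop :=
  (n3 <> 0%Z /\ curl_mode h pm n2 n3 lam Phi) \/
  (n3 = 0%Z /\ planar_mode h Phi).

Definition V_field (Omega h : R) (pm : bool) (n3 : Z) (lam : R)
    (Phi : point -> cvec) (t : R) (y : point) : cvec :=
  vadd
    (vscal (RtoC (Omega / 2)) (cross e3 (cvec_of_point y)))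
    (vscal (cis (sgn pm * (IZR n3 / Rabs lam) * alpha h * Omega * t))
       (rot_vec (Omega / 2 * t) (Phi (rot_point (- (Omega / 2 * t)) y)))).

(* V(t, y) = F(w1 t, w2 t, y) with F continuous and 2 pi-periodic in each of
   its first two arguments; w1 and w2 may be rationally dependent. *)
Definition quasiperiodic_T2 (V : R -> point -> cvec) : Prop :=
  exists (w1 w2 : R) (F : R -> R -> point -> cvec),
    (forall a b y, closed_tube y ->
       F (a + 2 * PI) b y = F a b y /\ F a (b + 2 * PI) y = F a b y) /\
    (forall a b y, closed_tube y ->
       let G := fun q : R * R * point => F (fst (fst q)) (snd (fst q)) (snd q) in
       continuous (U := C_R_NormedModule) (fun q => c1 (G q)) (a, b, y) /\
       continuous (U := C_R_NormedModule) (fun q => c2 (G q)) (a, b, y) /\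
       continuous (U := C_R_NormedModule) (fun q => c3 (G q)) (a, b, y)) /\
    (forall t y, closed_tube y -> V t y = F (w1 * t) (w2 * t) y).

(* Classical solutions: V and p are C^1 in (t, y) jointly, up to the lateral
   boundary. *)
Definition Euler_solution (h : R) (V : R -> point -> cvec)
    (p : R -> point -> C) : Prop :=
  (exists rho, radius < rho /\
     let D := fun q : R * point => tube rho (snd q) in
     C1_vec_on (U := prod_NormedModule _ R_NormedModule R3) D
       (fun q => V (fst q) (snd q)) /\
     C1_on (U := prod_NormedModule _ R_NormedModule R3) D
       (fun q => p (fst q) (snd q))) /\
  (forall t y, cylinder h y ->
     vadd (dt V t y) (advect (V t) (V t) y) = vopp (grad (p t) y)) /\
  (forall t y, cylinder h y -> div (V t) y = RtoC 0) /\
  (forall t, periodic h (V t) /\ periodic h (p t)) /\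
  (forall t, tangential (V t)).

(* Main.v *)
(* In the frame rotating with angular velocity Omega/2 the field becomes
   W = e^{i kappa t} Phi, and the Euler equations read
     dW/dt + (W . grad) W + Omega e3 x W = - grad q
   once the centrifugal term is put into the pressure.  Both kinds of modes make
   the nonlinear and the linear part separately gradients.
   If curl Phi = L Phi, then (Phi . grad) Phi = grad (Phi . Phi / 2), and
   L e3 x Phi = e3 x curl Phi = grad Phi_3 - d3 Phi with d3 Phi = i alpha n3 Phi,
   so i kappa Phi + Omega e3 x Phi = (Omega / L) grad Phi_3 exactly when
   kappa = alpha n3 Omega / L.
   If Phi = (d2 f, - d1 f, f) with f independent of y3 and - Delta f = mu f, then
   e3 x Phi = grad f and (Phi . grad) Phi = grad (|grad f|^2 + mu f^2) / 2, so
   kappa = 0. *)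

From Stdlib Require Import Reals ZArith Lra FunctionalExtensionality.
From Coquelicot Require Import Coquelicot.
Require Import Defs.
Open Scope R_scope.

(** * Continuously differentiable maps with an explicit differential *)

(** The operators [d1], [d2], [d3] and [CDerive] mean something only once differentiability is
    known, and [Euler_solution] asks for joint C^1 regularity besides the equations. One explicit
    differential of the whole field in (phases, position) answers both needs: it is assembled by
    product and chain rules, it gives regularity and continuity at once, and every time or space
    derivative is its value on a fixed vector. The passage to the rotating frame is then a
    polynomial identity in the fixed frame, with the relation cos^2 + sin^2 = 1 supplied by hand.
    Two points are analytic rather than algebraic. The separated form of a curl mode says nothing on
    the axis r = 0, so d3 Phi = i alpha n3 Phi has to be carried there by continuity. And a planar
    mode is divergence free only because mixed partial derivatives commute, which is proved from C^2
    regularity. *)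

Definition C1_diff {U V : NormedModule R_AbsRing} (D : U -> Prop) (f : U -> V)
    (df : U -> U -> V) : Prop :=
  forall x, D x ->
    filterdiff f (locally x) (df x) /\
    forall v, continuous (fun x' => df x' v) x.

Notation C1_real D f df := (C1_diff (V := R_NormedModule) D f df).
Notation C1_cplx D f df := (C1_diff (V := C_R_NormedModule) D f df).

Section Calculus.

Context {U : NormedModule R_AbsRing}.
Implicit Types D : U -> Prop.

Lemma C1_diff_continuous {V : NormedModule R_AbsRing} D (f : U -> V) df x :
  C1_diff D f df -> D x -> continuous f x.
Proof.
intros H Hx. apply (filterdiff_continuous f x). exists (df x). apply (H x Hx).
Qed.

(** Lets a differential produced by the calculus rules be replaced by a prescribed closed form, the
    two being compared by algebra alone. *)
Lemma C1_diff_eq {V : NormedModule R_AbsRing} D (f g : U -> V) df dg :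
  (forall x, f x = g x) -> (forall x v, df x v = dg x v) ->
  C1_diff D f df -> C1_diff D g dg.
Proof.
intros E Ed H x Hx. destruct (H x Hx) as [h1 h2]. split.
- eapply filterdiff_ext; [exact E |].
  eapply filterdiff_ext_lin; [exact h1 |]. intros v. apply Ed.
- intros v. eapply continuous_ext; [| exact (h2 v)]. intros y. apply Ed.
Qed.

Lemma C1_diff_const {V : NormedModule R_AbsRing} D (a : V) :
  C1_diff D (fun _ => a) (fun _ _ => zero).
Proof.
intros x _. split.
- apply filterdiff_const.
- intros v. apply continuous_const.
Qed.

Lemma C1_diff_linear {V : NormedModule R_AbsRing} D (l : U -> V) :
  is_linear l -> C1_diff D l (fun _ v => l v).
Proof.
intros Hl x _. split.
- now apply filterdiff_linear.
- intros v. apply continuous_const.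
Qed.

Lemma C1_diff_comp_linear {V W : NormedModule R_AbsRing} D (E : V -> Prop)
    (l : U -> V) (f : V -> W) df :
  is_linear l -> (forall x, D x -> E (l x)) -> C1_diff E f df ->
  C1_diff D (fun x => f (l x)) (fun x v => df (l x) (l v)).
Proof.
intros Hl HE Hf x Hx. destruct (Hf _ (HE _ Hx)) as [H1 H2]. split.
- apply (filterdiff_comp' l f).
  + now apply filterdiff_linear.
  + exact H1.
- intros v. apply (continuous_comp l (fun y => df y (l v))).
  + now apply linear_cont.
  + apply H2.
Qed.

Lemma C1_diff_pair {V W : NormedModule R_AbsRing} D (f : U -> V) (g : U -> W)
    df dg :
  C1_diff D f df -> C1_diff D g dg ->
  C1_diff (V := prod_NormedModule _ V W) D (fun x => (f x, g x))
    (fun x v => (df x v, dg x v)).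
Proof.
intros Hf Hg x Hx. destruct (Hf x Hx) as [f1 f2]. destruct (Hg x Hx) as [g1 g2].
split.
- apply (filterdiff_comp'_2 (W := prod_NormedModule _ V W) f g
    (fun a b => (a, b)) x (df x) (dg x) (fun a b => (a, b))); try assumption.
  apply filterdiff_linear.
  apply (is_linear_prod (fun t => fst t) (fun t => snd t)).
  + apply is_linear_fst.
  + apply is_linear_snd.
- intros v.
  apply (continuous_comp_2 (fun x' => df x' v) (fun x' => dg x' v)
    (fun a b => (a, b)) x).
  + apply f2.
  + apply g2.
  + eapply continuous_ext; [| apply continuous_id]. now intros [a b].
Qed.

Lemma C1_diff_fst {V W : NormedModule R_AbsRing} D
    (f : U -> prod_NormedModule _ V W) df :
  C1_diff D f df -> C1_diff D (fun x => fst (f x)) (fun x v => fst (df x v)).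
Proof.
intros Hf x Hx. destruct (Hf x Hx) as [f1 f2]. split.
- apply (filterdiff_comp' f (fun t => fst t)); [exact f1 |].
  apply filterdiff_linear, is_linear_fst.
- intros v. apply (continuous_comp (fun x' => df x' v) (fun t => fst t)).
  + apply f2.
  + apply (linear_cont (fun t : prod_NormedModule _ V W => fst t)), is_linear_fst.
Qed.

Lemma C1_diff_snd {V W : NormedModule R_AbsRing} D
    (f : U -> prod_NormedModule _ V W) df :
  C1_diff D f df -> C1_diff D (fun x => snd (f x)) (fun x v => snd (df x v)).
Proof.
intros Hf x Hx. destruct (Hf x Hx) as [f1 f2]. split.
- apply (filterdiff_comp' f (fun t => snd t)); [exact f1 |].
  apply filterdiff_linear, is_linear_snd.
- intros v. apply (continuous_comp (fun x' => df x' v) (fun t => snd t)).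
  + apply f2.
  + apply (linear_cont (fun t : prod_NormedModule _ V W => snd t)), is_linear_snd.
Qed.

Lemma C1_real_plus D (f g : U -> R) df dg :
  C1_real D f df -> C1_real D g dg ->
  C1_real D (fun x => f x + g x) (fun x v => df x v + dg x v).
Proof.
intros Hf Hg x Hx. destruct (Hf x Hx) as [f1 f2]. destruct (Hg x Hx) as [g1 g2].
split.
- apply (filterdiff_plus_fct (V := R_NormedModule) f g (df x) (dg x) f1 g1).
- intros v. now apply (continuous_plus (V := R_NormedModule)).
Qed.

Lemma C1_real_opp D (f : U -> R) df :
  C1_real D f df -> C1_real D (fun x => - f x) (fun x v => - df x v).
Proof.
intros Hf x Hx. destruct (Hf x Hx) as [f1 f2].
split.
- apply (filterdiff_opp_fct (V := R_NormedModule) f (df x) f1).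
- intros v. now apply (continuous_opp (V := R_NormedModule)).
Qed.

Lemma C1_real_minus D (f g : U -> R) df dg :
  C1_real D f df -> C1_real D g dg ->
  C1_real D (fun x => f x - g x) (fun x v => df x v - dg x v).
Proof.
intros Hf Hg. apply (C1_real_plus D f (fun x => - g x)); [exact Hf |].
now apply C1_real_opp.
Qed.

Lemma C1_real_mult D (f g : U -> R) df dg :
  C1_real D f df -> C1_real D g dg ->
  C1_real D (fun x => f x * g x) (fun x v => df x v * g x + f x * dg x v).
Proof.
intros Hf Hg x Hx.
assert (cf := C1_diff_continuous D _ _ _ Hf Hx).
assert (cg := C1_diff_continuous D _ _ _ Hg Hx).
destruct (Hf x Hx) as [f1 f2]. destruct (Hg x Hx) as [g1 g2].
split.
- apply (filterdiff_mult_fct (K := R_AbsRing) f g x (df x) (dg x) Rmult_comm f1 g1).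
- intros v. apply (continuous_plus (V := R_NormedModule)).
  + now apply (continuous_mult (K := R_AbsRing)).
  + now apply (continuous_mult (K := R_AbsRing)).
Qed.

Lemma C1_real_comp D (f : U -> R) df (g dg : R -> R) :
  (forall x, is_derive g x (dg x)) -> (forall x, continuous dg x) ->
  C1_real D f df ->
  C1_real D (fun x => g (f x)) (fun x v => df x v * dg (f x)).
Proof.
intros Hg cg Hf x Hx.
assert (cf := C1_diff_continuous D _ _ _ Hf Hx).
destruct (Hf x Hx) as [f1 f2]. split.
- apply (filterdiff_comp' (V := R_NormedModule) (W := R_NormedModule) f g x
    (df x) (fun y => scal y (dg (f x))) f1 (Hg (f x))).
- intros v. apply (continuous_mult (K := R_AbsRing)).
  + apply f2.
  + now apply (continuous_comp f dg).
Qed.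

Lemma C1_real_cos D (f : U -> R) df :
  C1_real D f df ->
  C1_real D (fun x => cos (f x)) (fun x v => df x v * - sin (f x)).
Proof.
apply (C1_real_comp D f df cos (fun x => - sin x)).
- exact is_derive_cos.
- intros x. apply (continuous_opp (V := R_NormedModule)), continuous_sin.
Qed.

Lemma C1_real_sin D (f : U -> R) df :
  C1_real D f df ->
  C1_real D (fun x => sin (f x)) (fun x v => df x v * cos (f x)).
Proof.
apply (C1_real_comp D f df sin cos).
- exact is_derive_sin.
- exact continuous_cos.
Qed.

Lemma C1_cplx_pair D (f g : U -> R) df dg :
  C1_real D f df -> C1_real D g dg ->
  C1_cplx D (fun x => (f x, g x)) (fun x v => (df x v, dg x v)).
Proof. apply (C1_diff_pair (V := R_NormedModule) (W := R_NormedModule)). Qed.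

Lemma C1_cplx_Re D (f : U -> C) df :
  C1_cplx D f df -> C1_real D (fun x => Re (f x)) (fun x v => Re (df x v)).
Proof. apply (C1_diff_fst (V := R_NormedModule) (W := R_NormedModule)). Qed.

Lemma C1_cplx_Im D (f : U -> C) df :
  C1_cplx D f df -> C1_real D (fun x => Im (f x)) (fun x v => Im (df x v)).
Proof. apply (C1_diff_snd (V := R_NormedModule) (W := R_NormedModule)). Qed.

Lemma C1_cplx_RtoC D (f : U -> R) df :
  C1_real D f df -> C1_cplx D (fun x => RtoC (f x)) (fun x v => RtoC (df x v)).
Proof.
intros Hf. apply C1_cplx_pair; [exact Hf |].
apply (C1_diff_const (V := R_NormedModule)).
Qed.

Lemma C1_cplx_cis D (f : U -> R) df :
  C1_real D f df ->
  C1_cplx D (fun x => cis (f x)) (fun x v => (RtoC (df x v) * (Ci * cis (f x)))%C).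
Proof.
intros Hf.
assert (H := C1_cplx_pair D _ _ _ _ (C1_real_cos D f df Hf) (C1_real_sin D f df Hf)).
eapply C1_diff_eq; [| | exact H].
- reflexivity.
- intros x v. unfold cis, RtoC, Ci, Cmult; simpl. f_equal; ring.
Qed.

Lemma C1_cplx_plus D (f g : U -> C) df dg :
  C1_cplx D f df -> C1_cplx D g dg ->
  C1_cplx D (fun x => (f x + g x)%C) (fun x v => (df x v + dg x v)%C).
Proof.
intros Hf Hg x Hx. destruct (Hf x Hx) as [f1 f2]. destruct (Hg x Hx) as [g1 g2].
split.
- apply (filterdiff_plus_fct (V := C_R_NormedModule) f g (df x) (dg x) f1 g1).
- intros v. now apply (continuous_plus (V := C_R_NormedModule)).
Qed.

Lemma C1_cplx_opp D (f : U -> C) df :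
  C1_cplx D f df -> C1_cplx D (fun x => (- f x)%C) (fun x v => (- df x v)%C).
Proof.
intros Hf x Hx. destruct (Hf x Hx) as [f1 f2].
split.
- apply (filterdiff_opp_fct (V := C_R_NormedModule) f (df x) f1).
- intros v. now apply (continuous_opp (V := C_R_NormedModule)).
Qed.

Lemma C1_cplx_minus D (f g : U -> C) df dg :
  C1_cplx D f df -> C1_cplx D g dg ->
  C1_cplx D (fun x => (f x - g x)%C) (fun x v => (df x v - dg x v)%C).
Proof.
intros Hf Hg. apply (C1_cplx_plus D f (fun x => (- g x)%C)); [exact Hf |].
now apply C1_cplx_opp.
Qed.

(** C is treated as a module over R, so the rule is assembled from real and imaginary parts with the
    product rule for real functions. *)
Lemma C1_cplx_mult D (f g : U -> C) df dg :
  C1_cplx D f df -> C1_cplx D g dg ->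
  C1_cplx D (fun x => (f x * g x)%C)
    (fun x v => (df x v * g x + f x * dg x v)%C).
Proof.
intros Hf Hg.
assert (fr := C1_cplx_Re D _ _ Hf). assert (fi := C1_cplx_Im D _ _ Hf).
assert (gr := C1_cplx_Re D _ _ Hg). assert (gi := C1_cplx_Im D _ _ Hg).
eapply C1_diff_eq; cycle 2.
- apply C1_cplx_pair.
  + apply (C1_real_minus D _ _ _ _ (C1_real_mult D _ _ _ _ fr gr)
      (C1_real_mult D _ _ _ _ fi gi)).
  + apply (C1_real_plus D _ _ _ _ (C1_real_mult D _ _ _ _ fr gi)
      (C1_real_mult D _ _ _ _ fi gr)).
- reflexivity.
- intros x v. unfold Cplus, Cmult, Re, Im; simpl. f_equal; ring.
Qed.

(** The common source of all derivatives below: a partial derivative restricts to a line of basis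
    velocity, a time derivative to one of velocity (w1, w2, 0) in [spacetime]. *)
Lemma is_derive_line D (g : U -> R) dg (line : R -> U) (s : R) (v : U) :
  C1_real D g dg -> D (line s) ->
  (forall u, line u = plus (line s) (scal (u - s) v)) ->
  is_derive (fun u => g (line u)) s (dg (line s) v).
Proof.
intros Hg Hs Hl.
assert (L : is_derive line s v).
{ assert (L1 : is_derive (fun u : R => scal (u - s) v) s (scal 1 v)).
  { apply (is_derive_scal_l (V := U) (fun u => u - s) s 1 v). auto_derive; auto. }
  assert (E1 : scal 1 v = v) by exact (scal_one v). rewrite E1 in L1.
  assert (L := is_derive_plus _ _ s _ _ (is_derive_const (V := U) (line s) s) L1).
  rewrite plus_zero_l in L.
  apply (is_derive_ext (fun u => plus (line s) (scal (u - s) v))); [| exact L].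
  intros u. now rewrite <- Hl. }
destruct (Hg _ Hs) as [G _].
eapply filterdiff_ext_lin.
- apply (filterdiff_comp' (W := R_NormedModule) line g s _ _ L G).
- intros y. apply (linear_scal _ (proj1 G)).
Qed.

Lemma CDerive_line D (f : U -> C) df (line : R -> U) (s : R) (v : U) :
  C1_cplx D f df -> D (line s) ->
  (forall u, line u = plus (line s) (scal (u - s) v)) ->
  CDerive (fun u => f (line u)) s = df (line s) v.
Proof.
intros Hf Hs Hl. unfold CDerive.
assert (E1 := is_derive_unique _ _ _
  (is_derive_line D _ _ line s v (C1_cplx_Re D f df Hf) Hs Hl)).
assert (E2 := is_derive_unique _ _ _
  (is_derive_line D _ _ line s v (C1_cplx_Im D f df Hf) Hs Hl)).
etransitivity; [exact (f_equal2 pair E1 E2) |].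
now destruct (df (line s) v).
Qed.

End Calculus.

Ltac C_ring := match goal with |- ?a = ?b => change (@eq C a b) end; ring.

(* Two time variables and a point: the torus parameters [(a, b)] of the
   quasiperiodic motion are kept independent until [a = Omega t / 2] and
   [b = kappa t] are substituted. *)
Definition spacetime : NormedModule R_AbsRing :=
  prod_NormedModule _ (prod_NormedModule _ R_NormedModule R_NormedModule) R3.

Definition phase_a (q : spacetime) : R := fst (fst q).
Definition phase_b (q : spacetime) : R := snd (fst q).
Definition place (q : spacetime) : R3 := snd q.

Lemma is_linear_x1 : is_linear (U := R3) (V := R_NormedModule) x1.
Proof.
apply (is_linear_comp (U := R3)
  (V := prod_NormedModule _ R_NormedModule R_NormedModule)
  (W := R_NormedModule) (fun y => fst y) (fun y => fst y)); apply is_linear_fst.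
Qed.

Lemma is_linear_x2 : is_linear (U := R3) (V := R_NormedModule) x2.
Proof.
apply (is_linear_comp (U := R3)
  (V := prod_NormedModule _ R_NormedModule R_NormedModule)
  (W := R_NormedModule) (fun y => fst y) (fun y => snd y)).
- apply is_linear_fst.
- apply is_linear_snd.
Qed.

Lemma is_linear_x3 : is_linear (U := R3) (V := R_NormedModule) x3.
Proof. apply is_linear_snd. Qed.

Lemma is_linear_phase_a : is_linear (V := R_NormedModule) phase_a.
Proof.
apply (is_linear_comp (U := spacetime)
  (V := prod_NormedModule _ R_NormedModule R_NormedModule)
  (W := R_NormedModule) (fun y => fst y) (fun y => fst y)); apply is_linear_fst.
Qed.

Lemma is_linear_phase_b : is_linear (V := R_NormedModule) phase_b.
Proof.
apply (is_linear_comp (U := spacetime)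
  (V := prod_NormedModule _ R_NormedModule R_NormedModule)
  (W := R_NormedModule) (fun y => fst y) (fun y => snd y)).
- apply is_linear_fst.
- apply is_linear_snd.
Qed.

Lemma is_linear_place : is_linear (V := R3) place.
Proof. apply is_linear_snd. Qed.

Lemma tube_open rho (y : R3) : tube rho y -> locally y (tube rho).
Proof.
intros Hy.
assert (H1 := C1_diff_linear (fun _ => True) _ is_linear_x1).
assert (H2 := C1_diff_linear (fun _ => True) _ is_linear_x2).
assert (H := C1_real_plus _ _ _ _ _ (C1_real_mult _ _ _ _ _ H1 H1)
  (C1_real_mult _ _ _ _ _ H2 H2)).
assert (c := C1_diff_continuous _ _ _ y H I).
assert (O := c (fun z => z < rho ^ 2)
  (open_lt (rho ^ 2) (x1 y * x1 y + x2 y * x2 y)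
    ltac:(unfold tube in Hy; simpl in *; lra))).
unfold filtermap in O. revert O. apply filter_imp.
intros z. unfold tube. simpl. intros Hz. lra.
Qed.

Ltac module_ring :=
  repeat (unfold plus, scal; simpl; unfold prod_plus, prod_scal, mult; simpl);
  repeat apply injective_projections; simpl;
  match goal with |- ?a = ?b => change (@eq R a b) end; first [ring | symmetry; ring].

(** * Partial derivatives and the total differential *)

Section Partials.

Variables (D : R3 -> Prop) (f : R3 -> C) (df : R3 -> R3 -> C).
Hypothesis Hf : C1_cplx D f df.

Lemma d1_C1 (y : R3) : D y -> d1 f y = df y (1, 0, 0).
Proof.
intros Hy. unfold d1.
rewrite (CDerive_line D f df (fun s => (s, x2 y, x3 y)) (x1 y) (1, 0, 0));
  destruct y as [[a b] c]; unfold x1, x2, x3; simpl; try assumption; [reflexivity |].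
intros u. module_ring.
Qed.

Lemma d2_C1 (y : R3) : D y -> d2 f y = df y (0, 1, 0).
Proof.
intros Hy. unfold d2.
rewrite (CDerive_line D f df (fun s => (x1 y, s, x3 y)) (x2 y) (0, 1, 0));
  destruct y as [[a b] c]; unfold x1, x2, x3; simpl; try assumption; [reflexivity |].
intros u. module_ring.
Qed.

Lemma d3_C1 (y : R3) : D y -> d3 f y = df y (0, 0, 1).
Proof.
intros Hy. unfold d3.
rewrite (CDerive_line D f df (fun s => (x1 y, x2 y, s)) (x3 y) (0, 0, 1));
  destruct y as [[a b] c]; unfold x1, x2, x3; simpl; try assumption; [reflexivity |].
intros u. module_ring.
Qed.

End Partials.

Definition total_d (f : point -> C) (y v : point) : C :=
  (RtoC (x1 v) * d1 f y + RtoC (x2 v) * d2 f y + RtoC (x3 v) * d3 f y)%C.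

(** The differential hidden in [C1_on] is linear, hence fixed by its values on the basis, which are
    the partial derivatives. This makes it canonical. *)
Lemma C1_on_total_d rho (f : point -> C) :
  C1_on (U := R3) (tube rho) f ->
  C1_diff (U := R3) (V := C_R_NormedModule) (tube rho) f (total_d f).
Proof.
intros [df Hdf].
assert (H : C1_diff (U := R3) (V := C_R_NormedModule) (tube rho) f df)
  by exact Hdf.
assert (E : forall y, tube rho y -> forall v, df y v = total_d f y v).
{ intros y Hy v. unfold total_d.
  rewrite (d1_C1 _ _ _ H y Hy), (d2_C1 _ _ _ H y Hy), (d3_C1 _ _ _ H y Hy).
  destruct (H y Hy) as [[L _] _].
  destruct v as [[a b] c]; unfold x1, x2, x3; simpl.
  assert (S : forall (k : R) (w : R3), (RtoC k * df y w)%C = df y (scal k w)).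
  { intros k w. rewrite (linear_scal _ L). unfold scal; simpl.
    unfold prod_scal, RtoC, Cmult, scal; simpl. unfold mult; simpl.
    f_equal; ring. }
  assert (A : forall (v w : R3), (df y v + df y w)%C = df y (plus v w)).
  { intros v w. now rewrite (linear_plus _ L). }
  rewrite !S, !A. f_equal. module_ring. }
intros y Hy. destruct (H y Hy) as [h1 h2]. split.
- eapply filterdiff_ext_lin; [exact h1 |]. intros v. now apply E.
(* The two differentials agree on the tube only, so its openness is needed to transfer
   continuity. *)
- intros v. apply (continuous_ext_loc _ (fun x' => df x' v)); [| apply h2].
  generalize (tube_open rho y Hy). apply filter_imp. intros z Hz. now apply E.
Qed.

Lemma C1_on_continuous_d rho (f : point -> C) (y : R3) :
  C1_on (U := R3) (tube rho) f -> tube rho y ->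
  continuous (U := C_R_NormedModule) (d1 f) y /\
  continuous (U := C_R_NormedModule) (d2 f) y /\
  continuous (U := C_R_NormedModule) (d3 f) y.
Proof.
intros H Hy. destruct (C1_on_total_d rho f H y Hy) as [_ h].
repeat split;
 [ assert (c := h (1, 0, 0)) | assert (c := h (0, 1, 0)) | assert (c := h (0, 0, 1)) ];
 (eapply continuous_ext; [| exact c]); intros z;
 unfold total_d, x1, x2, x3; simpl; ring.
Qed.

Lemma C1_cplx_chain {U : NormedModule R_AbsRing} (D : U -> Prop) rho
    (f : point -> C) (u1 u2 u3 : U -> R) du1 du2 du3 :
  C1_on (U := R3) (tube rho) f ->
  (forall q, D q -> tube rho (u1 q, u2 q, u3 q)) ->
  C1_real D u1 du1 -> C1_real D u2 du2 -> C1_real D u3 du3 ->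
  C1_cplx D (fun q => f (u1 q, u2 q, u3 q))
    (fun q v => total_d f (u1 q, u2 q, u3 q) (du1 q v, du2 q v, du3 q v)).
Proof.
intros Hf HD H1 H2 H3.
assert (Hu := C1_diff_pair _ _ _ _ _ (C1_diff_pair _ _ _ _ _ H1 H2) H3).
intros q Hq. assert (cu := C1_diff_continuous _ _ _ _ Hu Hq).
destruct (Hu q Hq) as [u' _].
destruct (H1 q Hq) as [_ c1]. destruct (H2 q Hq) as [_ c2].
destruct (H3 q Hq) as [_ c3].
split.
- apply (filterdiff_comp' (V := R3) (W := C_R_NormedModule)
    (fun q => (u1 q, u2 q, u3 q)) f q
    (fun v => (du1 q v, du2 q v, du3 q v)) (total_d f (u1 q, u2 q, u3 q)) u').
  apply (C1_on_total_d rho f Hf). now apply HD.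
- intros v.
  destruct (C1_on_continuous_d rho f _ Hf (HD q Hq)) as (k1 & k2 & k3).
  assert (M : forall (g : U -> R) (d : point -> C), continuous g q ->
    continuous (T := R3) (U := C_R_NormedModule) d (u1 q, u2 q, u3 q) ->
    continuous (U := C_R_NormedModule)
      (fun q => (RtoC (g q) * d (u1 q, u2 q, u3 q))%C) q).
  { intros g d Hg Hd.
    assert (Hdu := continuous_comp (V := R3) _ d q cu Hd).
    eapply continuous_ext; [|
      exact (continuous_scal (K := R_AbsRing) (V := C_R_NormedModule) g _ q Hg Hdu)].
    intros z. unfold scal; simpl. unfold prod_scal, RtoC, Cmult, scal; simpl.
    unfold mult; simpl. f_equal; ring. }
  unfold total_d, x1, x2, x3; simpl.
  apply (continuous_plus (V := C_R_NormedModule)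
    (fun q => (RtoC (du1 q v) * d1 f (u1 q, u2 q, u3 q)
      + RtoC (du2 q v) * d2 f (u1 q, u2 q, u3 q))%C)); [| now apply M].
  apply (continuous_plus (V := C_R_NormedModule)
    (fun q => (RtoC (du1 q v) * d1 f (u1 q, u2 q, u3 q))%C)); now apply M.
Qed.

(** * Fields and pressure in corotating coordinates *)

Definition moving_tube (rho : R) (q : spacetime) : Prop := tube rho (place q).

Lemma rot_point_norm a y :
  x1 (rot_point a y) ^ 2 + x2 (rot_point a y) ^ 2 = x1 y ^ 2 + x2 y ^ 2.
Proof.
unfold rot_point, x1, x2; simpl. generalize (sin2_cos2 a); unfold Rsqr; intros H.
transitivity ((sin a * sin a + cos a * cos a)
  * (fst (fst y) * fst (fst y) + snd (fst y) * snd (fst y))); [ring |].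
rewrite H. ring.
Qed.

Lemma rot_point_tube rho a y : tube rho y -> tube rho (rot_point a y).
Proof. unfold tube. now rewrite rot_point_norm. Qed.

(** Differential of [f (rot_point (- a) y)] in the direction (da, dy). The terms in [da] come from
    d/da exp(-aJ) y = -J exp(-aJ) y and -J (x1, x2) = (x2, -x1). *)
Definition rot_total_d (f : point -> C) (a : R) (y : point) (da : R)
    (dy : point) : C :=
  let x := rot_point (- a) y in
  let dx := rot_point (- a) dy in
  (RtoC (da * x2 x + x1 dx) * d1 f x + RtoC (- (da * x1 x) + x2 dx) * d2 f x
   + RtoC (x3 dx) * d3 f x)%C.

Lemma corotating_C1 rho (f : point -> C) :
  C1_on (U := R3) (tube rho) f ->
  C1_cplx (moving_tube rho) (fun q => f (rot_point (- phase_a q) (place q)))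
    (fun q v => rot_total_d f (phase_a q) (place q) (phase_a v) (place v)).
Proof.
intros Hf.
assert (Ha := C1_diff_linear (moving_tube rho) _ is_linear_phase_a).
assert (H1 := C1_diff_linear (moving_tube rho) _
  (is_linear_comp _ _ is_linear_place is_linear_x1)).
assert (H2 := C1_diff_linear (moving_tube rho) _
  (is_linear_comp _ _ is_linear_place is_linear_x2)).
assert (H3 := C1_diff_linear (moving_tube rho) _
  (is_linear_comp _ _ is_linear_place is_linear_x3)).
assert (Hn := C1_real_opp _ _ _ Ha).
assert (Hc := C1_real_cos _ _ _ Hn). assert (Hs := C1_real_sin _ _ _ Hn).
eapply C1_diff_eq; cycle 2.
- eapply (C1_cplx_chain (moving_tube rho) rho f); [exact Hf | ..]; cycle 1.
  + exact (C1_real_minus _ _ _ _ _ (C1_real_mult _ _ _ _ _ Hc H1)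
      (C1_real_mult _ _ _ _ _ Hs H2)).
  + exact (C1_real_plus _ _ _ _ _ (C1_real_mult _ _ _ _ _ Hs H1)
      (C1_real_mult _ _ _ _ _ Hc H2)).
  + exact H3.
  + intros q Hq. exact (rot_point_tube rho (- phase_a q) (place q) Hq).
- reflexivity.
- intros q v. unfold rot_total_d, total_d.
  unfold rot_point, x1, x2, x3. cbn [fst snd].
  repeat (f_equal; try ring).
Qed.

Definition wave (Omega : R) (Phi : point -> cvec) (a b : R) (y : point) : cvec :=
  vadd (vscal (RtoC (Omega / 2)) (cross e3 (cvec_of_point y)))
    (vscal (cis b) (rot_vec a (Phi (rot_point (- a) y)))).

(** The first term is the centrifugal potential: the solid rotation advects itself with acceleration
    -(Omega^2/4) (y1, y2, 0). The potential [q1] balances the terms linear in the mode and carries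
    one factor e^{ib}; [q2] balances the quadratic term, which carries e^{2ib} because nothing is
    conjugated. *)
Definition wave_pressure (Omega : R) (q1 q2 : point -> C) (a b : R) (y : point) : C :=
  (RtoC (Omega * Omega / 8 * (x1 y * x1 y + x2 y * x2 y))
   + cis b * (q1 (rot_point (- a) y) + cis b * q2 (rot_point (- a) y)))%C.

Section Wave_C1.

Variables (Omega rho : R) (Phi : point -> cvec) (q1 q2 : point -> C).
Hypothesis HPhi : C1_vec_on (U := R3) (tube rho) Phi.

Let P1 y := c1 (Phi y).
Let P2 y := c2 (Phi y).
Let P3 y := c3 (Phi y).

(** Besides the solid rotation there are three contributions: the phase ([db]), the turning of the
    vector components ([da]), and the moving argument ([rot_total_d]). *)
Definition d_wave1 (a b : R) (y : point) (da db : R) (dy : point) : C :=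
  let x := rot_point (- a) y in
  (- RtoC (Omega / 2) * RtoC (x2 dy)
   + cis b * (RtoC db * Ci * (RtoC (cos a) * P1 x - RtoC (sin a) * P2 x)
     - RtoC da * (RtoC (sin a) * P1 x + RtoC (cos a) * P2 x)
     + (RtoC (cos a) * rot_total_d P1 a y da dy
        - RtoC (sin a) * rot_total_d P2 a y da dy)))%C.

Definition d_wave2 (a b : R) (y : point) (da db : R) (dy : point) : C :=
  let x := rot_point (- a) y in
  (RtoC (Omega / 2) * RtoC (x1 dy)
   + cis b * (RtoC db * Ci * (RtoC (sin a) * P1 x + RtoC (cos a) * P2 x)
     + RtoC da * (RtoC (cos a) * P1 x - RtoC (sin a) * P2 x)
     + (RtoC (sin a) * rot_total_d P1 a y da dy
        + RtoC (cos a) * rot_total_d P2 a y da dy)))%C.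

Definition d_wave3 (a b : R) (y : point) (da db : R) (dy : point) : C :=
  (cis b * (RtoC db * Ci * P3 (rot_point (- a) y) + rot_total_d P3 a y da dy))%C.

Definition d_pressure (a b : R) (y : point) (da db : R) (dy : point) : C :=
  let x := rot_point (- a) y in
  (RtoC (Omega * Omega / 4) * (RtoC (x1 y) * RtoC (x1 dy) + RtoC (x2 y) * RtoC (x2 dy))
   + cis b * (RtoC db * Ci * (q1 x + 2 * cis b * q2 x)
     + (rot_total_d q1 a y da dy + cis b * rot_total_d q2 a y da dy)))%C.

Let E := moving_tube rho.

Lemma wave1_C1 :
  C1_cplx E (fun q => c1 (wave Omega Phi (phase_a q) (phase_b q) (place q)))
    (fun q v => d_wave1 (phase_a q) (phase_b q) (place q)
       (phase_a v) (phase_b v) (place v)).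
Proof.
destruct HPhi as (H1 & H2 & H3).
assert (Ha := C1_diff_linear E _ is_linear_phase_a).
assert (Hb := C1_cplx_cis _ _ _ (C1_diff_linear E _ is_linear_phase_b)).
assert (Hc := C1_cplx_RtoC _ _ _ (C1_real_cos _ _ _ Ha)).
assert (Hs := C1_cplx_RtoC _ _ _ (C1_real_sin _ _ _ Ha)).
assert (Hx := C1_cplx_RtoC _ _ _ (C1_diff_linear E _
  (is_linear_comp _ _ is_linear_place is_linear_x2))).
assert (HO := C1_diff_const (V := C_R_NormedModule) E (- RtoC (Omega / 2))%C).
eapply C1_diff_eq; cycle 2.
- exact (C1_cplx_plus _ _ _ _ _ (C1_cplx_mult _ _ _ _ _ HO Hx)
    (C1_cplx_mult _ _ _ _ _ Hb
      (C1_cplx_minus _ _ _ _ _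
         (C1_cplx_mult _ _ _ _ _ Hc (corotating_C1 rho P1 H1))
         (C1_cplx_mult _ _ _ _ _ Hs (corotating_C1 rho P2 H2))))).
- intros q. unfold P1, P2, P3, wave, vadd, vscal, cross, rot_vec, cvec_of_point,
     e3, c1, c2, c3.
  cbn [fst snd]. C_ring.
- intros q v. unfold d_wave1.
  cbv beta. change (@zero C_R_NormedModule) with (RtoC 0).
  rewrite !RtoC_mult, !RtoC_opp. C_ring.
Qed.

Lemma wave2_C1 :
  C1_cplx E (fun q => c2 (wave Omega Phi (phase_a q) (phase_b q) (place q)))
    (fun q v => d_wave2 (phase_a q) (phase_b q) (place q)
       (phase_a v) (phase_b v) (place v)).
Proof.
destruct HPhi as (H1 & H2 & H3).
assert (Ha := C1_diff_linear E _ is_linear_phase_a).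
assert (Hb := C1_cplx_cis _ _ _ (C1_diff_linear E _ is_linear_phase_b)).
assert (Hc := C1_cplx_RtoC _ _ _ (C1_real_cos _ _ _ Ha)).
assert (Hs := C1_cplx_RtoC _ _ _ (C1_real_sin _ _ _ Ha)).
assert (Hx := C1_cplx_RtoC _ _ _ (C1_diff_linear E _
  (is_linear_comp _ _ is_linear_place is_linear_x1))).
assert (HO := C1_diff_const (V := C_R_NormedModule) E (RtoC (Omega / 2))%C).
eapply C1_diff_eq; cycle 2.
- exact (C1_cplx_plus _ _ _ _ _ (C1_cplx_mult _ _ _ _ _ HO Hx)
    (C1_cplx_mult _ _ _ _ _ Hb
      (C1_cplx_plus _ _ _ _ _
         (C1_cplx_mult _ _ _ _ _ Hs (corotating_C1 rho P1 H1))
         (C1_cplx_mult _ _ _ _ _ Hc (corotating_C1 rho P2 H2))))).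
- intros q. unfold P1, P2, P3, wave, vadd, vscal, cross, rot_vec, cvec_of_point,
     e3, c1, c2, c3.
  cbn [fst snd]. C_ring.
- intros q v. unfold d_wave2.
  cbv beta. change (@zero C_R_NormedModule) with (RtoC 0).
  rewrite !RtoC_mult, !RtoC_opp. C_ring.
Qed.

Lemma wave3_C1 :
  C1_cplx E (fun q => c3 (wave Omega Phi (phase_a q) (phase_b q) (place q)))
    (fun q v => d_wave3 (phase_a q) (phase_b q) (place q)
       (phase_a v) (phase_b v) (place v)).
Proof.
destruct HPhi as (H1 & H2 & H3).
assert (Hb := C1_cplx_cis _ _ _ (C1_diff_linear E _ is_linear_phase_b)).
eapply C1_diff_eq; cycle 2.
- exact (C1_cplx_mult _ _ _ _ _ Hb (corotating_C1 rho P3 H3)).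
- intros q. unfold P1, P2, P3, wave, vadd, vscal, cross, rot_vec, cvec_of_point,
     e3, c1, c2, c3.
  cbn [fst snd]. C_ring.
- intros q v. unfold d_wave3. C_ring.
Qed.

Hypotheses (Hq1 : C1_on (U := R3) (tube rho) q1)
  (Hq2 : C1_on (U := R3) (tube rho) q2).

Lemma wave_pressure_C1 :
  C1_cplx E (fun q => wave_pressure Omega q1 q2 (phase_a q) (phase_b q) (place q))
    (fun q v => d_pressure (phase_a q) (phase_b q) (place q)
       (phase_a v) (phase_b v) (place v)).
Proof.
assert (Hb := C1_cplx_cis _ _ _ (C1_diff_linear E _ is_linear_phase_b)).
assert (Hx1 := C1_diff_linear E _
  (is_linear_comp _ _ is_linear_place is_linear_x1)).
assert (Hx2 := C1_diff_linear E _
  (is_linear_comp _ _ is_linear_place is_linear_x2)).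
assert (HO := C1_diff_const (V := R_NormedModule) E (Omega * Omega / 8)).
eapply C1_diff_eq; cycle 2.
- exact (C1_cplx_plus _ _ _ _ _ (C1_cplx_RtoC _ _ _
     (C1_real_mult _ _ _ _ _ HO
       (C1_real_plus _ _ _ _ _ (C1_real_mult _ _ _ _ _ Hx1 Hx1)
         (C1_real_mult _ _ _ _ _ Hx2 Hx2))))
    (C1_cplx_mult _ _ _ _ _ Hb
      (C1_cplx_plus _ _ _ _ _ (corotating_C1 rho _ Hq1)
         (C1_cplx_mult _ _ _ _ _ Hb (corotating_C1 rho _ Hq2))))).
- reflexivity.
- intros q v. unfold d_pressure.
  cbv beta. change (@zero R_NormedModule) with 0.
  replace (Omega * Omega / 4) with (Omega * Omega / 8 * 2) by field.
  rewrite !RtoC_plus, !RtoC_mult, !RtoC_plus, !RtoC_mult. C_ring.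
Qed.

End Wave_C1.

(** * Time and space derivatives read off the spacetime differential *)

Section Spacetime_partials.

Variables (rho : R) (F : spacetime -> C) (dF : spacetime -> spacetime -> C).
Hypothesis HF : C1_cplx (moving_tube rho) F dF.

Lemma CDerive_time w1 w2 t (y : point) : tube rho y ->
  CDerive (fun s => F (w1 * s, w2 * s, y)) t
  = dF (w1 * t, w2 * t, y) (w1, w2, (0, 0, 0)).
Proof.
intros Hy.
apply (CDerive_line (moving_tube rho) F dF (fun s => (w1 * s, w2 * s, y)) t); auto.
intros u. destruct y as [[a b] c]. module_ring.
Qed.

Lemma d1_space a b (y : point) : tube rho y ->
  d1 (fun z => F (a, b, z)) y = dF (a, b, y) (0, 0, (1, 0, 0)).
Proof.
intros Hy. destruct y as [[y1 y2] y3].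
apply (CDerive_line (moving_tube rho) F dF (fun s => (a, b, (s, y2, y3))) y1); auto.
intros u. module_ring.
Qed.

Lemma d2_space a b (y : point) : tube rho y ->
  d2 (fun z => F (a, b, z)) y = dF (a, b, y) (0, 0, (0, 1, 0)).
Proof.
intros Hy. destruct y as [[y1 y2] y3].
apply (CDerive_line (moving_tube rho) F dF (fun s => (a, b, (y1, s, y3))) y2); auto.
intros u. module_ring.
Qed.

Lemma d3_space a b (y : point) : tube rho y ->
  d3 (fun z => F (a, b, z)) y = dF (a, b, y) (0, 0, (0, 0, 1)).
Proof.
intros Hy. destruct y as [[y1 y2] y3].
apply (CDerive_line (moving_tube rho) F dF (fun s => (a, b, (y1, y2, s))) y3); auto.
intros u. module_ring.
Qed.

(** Setting both phases to multiples of a single time is a linear substitution, so C^1 regularity is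
    inherited. *)
Lemma C1_on_spacetime w1 w2 :
  C1_on (U := prod_NormedModule _ R_NormedModule R3)
    (fun q => tube rho (snd q)) (fun q => F (w1 * fst q, w2 * fst q, snd q)).
Proof.
assert (L : is_linear (U := prod_NormedModule _ R_NormedModule R3)
  (V := spacetime) (fun q => (w1 * fst q, w2 * fst q, snd q))).
{ apply (is_linear_prod (U := prod_NormedModule _ R_NormedModule R_NormedModule)
    (V := R3) (fun q => (w1 * fst q, w2 * fst q)) (fun q => snd q));
    [| apply is_linear_snd].
  apply (is_linear_prod (U := R_NormedModule) (V := R_NormedModule)).
  - apply (is_linear_comp (fun q => fst q) (fun s : R_NormedModule => scal w1 s)).
    + apply is_linear_fst.
    + apply (is_linear_scal_r w1 Rmult_comm).
  - apply (is_linear_comp (fun q => fst q) (fun s : R_NormedModule => scal w2 s)).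
    + apply is_linear_fst.
    + apply (is_linear_scal_r w2 Rmult_comm). }
eexists.
exact (C1_diff_comp_linear (fun q => tube rho (snd q)) (moving_tube rho) _ F dF L
  (fun q H => H) HF).
Qed.

End Spacetime_partials.

(** * Algebra of the rotation *)

Lemma rot_point_neg a y :
  rot_point (- a) y = (cos a * x1 y + sin a * x2 y,
                       - sin a * x1 y + cos a * x2 y, x3 y).
Proof.
unfold rot_point. rewrite cos_neg, sin_neg. f_equal. f_equal; ring.
Qed.

Lemma rot_total_d_e1 f a y :
  rot_total_d f a y 0 (1, 0, 0) =
  (RtoC (cos a) * d1 f (rot_point (- a) y)
   - RtoC (sin a) * d2 f (rot_point (- a) y))%C.
Proof.
unfold rot_total_d; cbv zeta. rewrite (rot_point_neg a (1, 0, 0)).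
unfold x1, x2, x3; cbn [fst snd].
repeat rewrite ?RtoC_plus, ?RtoC_opp, ?RtoC_mult. ring.
Qed.

Lemma rot_total_d_e2 f a y :
  rot_total_d f a y 0 (0, 1, 0) =
  (RtoC (sin a) * d1 f (rot_point (- a) y)
   + RtoC (cos a) * d2 f (rot_point (- a) y))%C.
Proof.
unfold rot_total_d; cbv zeta. rewrite (rot_point_neg a (0, 1, 0)).
unfold x1, x2, x3; cbn [fst snd].
repeat rewrite ?RtoC_plus, ?RtoC_opp, ?RtoC_mult. ring.
Qed.

Lemma rot_total_d_e3 f a y :
  rot_total_d f a y 0 (0, 0, 1) = d3 f (rot_point (- a) y).
Proof.
unfold rot_total_d; cbv zeta. rewrite (rot_point_neg a (0, 0, 1)).
unfold x1, x2, x3; cbn [fst snd].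
repeat rewrite ?RtoC_plus, ?RtoC_opp, ?RtoC_mult. ring.
Qed.

(** Written in the coordinates of [y], not of the rotated point, so that with w = Omega/2 it cancels
    term by term against the advection by the solid rotation, whose velocity is expressed at [y]. *)
Lemma rot_total_d_time f a y w :
  rot_total_d f a y w (0, 0, 0) =
  (RtoC w * ((RtoC (cos a) * RtoC (x2 y) - RtoC (sin a) * RtoC (x1 y))
               * d1 f (rot_point (- a) y)
    - (RtoC (cos a) * RtoC (x1 y) + RtoC (sin a) * RtoC (x2 y))
               * d2 f (rot_point (- a) y)))%C.
Proof.
unfold rot_total_d; cbv zeta. rewrite (rot_point_neg a (0, 0, 0)).
set (X := rot_point (- a) y) at 2 4 5 6 7. rewrite (rot_point_neg a y).
unfold x1, x2, x3; cbn [fst snd].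
repeat rewrite ?RtoC_plus, ?RtoC_opp, ?RtoC_mult. ring.
Qed.

Lemma rot_point_shift a T y :
  rot_point a (x1 y, x2 y, x3 y + T)
  = (x1 (rot_point a y), x2 (rot_point a y), x3 (rot_point a y) + T).
Proof. reflexivity. Qed.

Lemma rot_point_cylinder h a y : cylinder h y -> cylinder h (rot_point a y).
Proof. unfold cylinder. now rewrite rot_point_norm. Qed.

Lemma closed_tube_tube rho y : radius < rho -> closed_tube y -> tube rho y.
Proof. unfold closed_tube, tube, radius. intros H H1. nra. Qed.

Lemma cylinder_closed_tube h y : cylinder h y -> closed_tube y.
Proof. intros [_ H]. now apply Rlt_le. Qed.

(** Ideal membership with an explicit cofactor [K]: an equation valid modulo u = 0 becomes an
    identity that [ring] decides. *)
Lemma Cminus_eq0_mult (u K a b : C) : u = 0%C -> (a - b)%C = (u * K)%C -> a = b.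
Proof.
intros -> H. replace a with ((a - b) + b)%C by ring. rewrite H. ring.
Qed.

Lemma C_cos2_sin2 a :
  (RtoC (cos a) * RtoC (cos a) + RtoC (sin a) * RtoC (sin a) - 1)%C = 0%C.
Proof.
rewrite <- !RtoC_mult, <- RtoC_plus.
replace (cos a * cos a + sin a * sin a) with 1; [ring |].
generalize (sin2_cos2 a). unfold Rsqr. lra.
Qed.

Lemma cvec_eq (u v : cvec) : c1 u = c1 v -> c2 u = c2 v -> c3 u = c3 v -> u = v.
Proof.
destruct u as [[u1 u2] u3], v as [[v1 v2] v3]. cbn. now intros -> -> ->.
Qed.

(** * Rotating waves *)

Section Rotating_wave.

Variables (Omega h kappa rho : R) (Phi : point -> cvec) (q1 q2 : point -> C).
Hypothesis Hrho : radius < rho.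
Hypothesis HPhi : C1_vec_on (U := R3) (tube rho) Phi.
Hypotheses (Hq1 : C1_on (U := R3) (tube rho) q1)
  (Hq2 : C1_on (U := R3) (tube rho) q2).
Hypotheses (Htan : tangential Phi) (Hper : periodic h Phi)
  (Hper1 : periodic h q1) (Hper2 : periodic h q2).
Hypothesis Hdiv : forall y, cylinder h y -> div Phi y = RtoC 0.
Hypothesis Hself : forall y, cylinder h y ->
  advect Phi Phi y = vopp (grad q2 y).
Hypothesis Hcoriolis : forall y, cylinder h y ->
  vadd (vscal (RtoC kappa * Ci)%C (Phi y)) (vscal (RtoC Omega) (cross e3 (Phi y)))
  = vopp (grad q1 y).

Let V (t : R) (y : point) := wave Omega Phi (Omega / 2 * t) (kappa * t) y.
Let p (t : R) (y : point) :=
  wave_pressure Omega q1 q2 (Omega / 2 * t) (kappa * t) y.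

Lemma wave_quasiperiodic : quasiperiodic_T2 V.
Proof.
(* One frequency belongs to the rotating frame, the other to the phase of the mode. *)
exists (Omega / 2), kappa, (wave Omega Phi). split; [| split].
- intros a b y _. unfold wave, rot_vec, rot_point, cis.
  rewrite !cos_neg, !sin_neg, !cos_plus, !sin_plus, cos_2PI, sin_2PI.
  rewrite !Rmult_0_r, !Rmult_1_r, !Rminus_0_r, !Rplus_0_r. now split.
- intros a b y Hy G.
  assert (Hq : moving_tube rho (a, b, y)) by now apply closed_tube_tube.
  split; [| split].
  + exact (C1_diff_continuous _ _ _ _ (wave1_C1 Omega rho Phi HPhi) Hq).
  + exact (C1_diff_continuous _ _ _ _ (wave2_C1 Omega rho Phi HPhi) Hq).
  + exact (C1_diff_continuous _ _ _ _ (wave3_C1 Omega rho Phi HPhi) Hq).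
- reflexivity.
Qed.

(* In the rotating frame the momentum equation splits by powers of
   [cis (kappa t)]: the centrifugal term, [Hcoriolis] and [Hself].  The
   transport of [Phi] by the solid rotation cancels the time derivative of the
   rotated variable.  What remains is a multiple of [cos^2 + sin^2 - 1]. *)
Lemma wave_momentum t y : cylinder h y ->
  vadd (dt V t y) (advect (V t) (V t) y) = vopp (grad (p t) y).
Proof.
intros Hcyl.
assert (Hy := closed_tube_tube rho y Hrho (cylinder_closed_tube h y Hcyl)).
assert (W1 := wave1_C1 Omega rho Phi HPhi).
assert (W2 := wave2_C1 Omega rho Phi HPhi).
assert (W3 := wave3_C1 Omega rho Phi HPhi).
assert (Wp := wave_pressure_C1 Omega rho q1 q2 Hq1 Hq2).
set (a := Omega / 2 * t). set (b := kappa * t). set (X := rot_point (- a) y).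
assert (T1 : CDerive (fun s => c1 (V s y)) t
  = d_wave1 Omega Phi a b y (Omega / 2) kappa (0, 0, 0))
  by exact (CDerive_time rho _ _ W1 (Omega / 2) kappa t y Hy).
assert (T2 : CDerive (fun s => c2 (V s y)) t
  = d_wave2 Omega Phi a b y (Omega / 2) kappa (0, 0, 0))
  by exact (CDerive_time rho _ _ W2 (Omega / 2) kappa t y Hy).
assert (T3 : CDerive (fun s => c3 (V s y)) t
  = d_wave3 Phi a b y (Omega / 2) kappa (0, 0, 0))
  by exact (CDerive_time rho _ _ W3 (Omega / 2) kappa t y Hy).
assert (D11 : d1 (fun z => c1 (V t z)) y
  = d_wave1 Omega Phi a b y 0 0 (1, 0, 0))
  by exact (d1_space rho _ _ W1 a b y Hy).
assert (D12 : d2 (fun z => c1 (V t z)) y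
  = d_wave1 Omega Phi a b y 0 0 (0, 1, 0))
  by exact (d2_space rho _ _ W1 a b y Hy).
assert (D13 : d3 (fun z => c1 (V t z)) y
  = d_wave1 Omega Phi a b y 0 0 (0, 0, 1))
  by exact (d3_space rho _ _ W1 a b y Hy).
assert (D21 : d1 (fun z => c2 (V t z)) y
  = d_wave2 Omega Phi a b y 0 0 (1, 0, 0))
  by exact (d1_space rho _ _ W2 a b y Hy).
assert (D22 : d2 (fun z => c2 (V t z)) y
  = d_wave2 Omega Phi a b y 0 0 (0, 1, 0))
  by exact (d2_space rho _ _ W2 a b y Hy).
assert (D23 : d3 (fun z => c2 (V t z)) y
  = d_wave2 Omega Phi a b y 0 0 (0, 0, 1))
  by exact (d3_space rho _ _ W2 a b y Hy).
assert (D31 : d1 (fun z => c3 (V t z)) y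
  = d_wave3 Phi a b y 0 0 (1, 0, 0))
  by exact (d1_space rho _ _ W3 a b y Hy).
assert (D32 : d2 (fun z => c3 (V t z)) y
  = d_wave3 Phi a b y 0 0 (0, 1, 0))
  by exact (d2_space rho _ _ W3 a b y Hy).
assert (D33 : d3 (fun z => c3 (V t z)) y
  = d_wave3 Phi a b y 0 0 (0, 0, 1))
  by exact (d3_space rho _ _ W3 a b y Hy).
assert (G1 : d1 (p t) y = d_pressure Omega q1 q2 a b y 0 0 (1, 0, 0))
  by exact (d1_space rho _ _ Wp a b y Hy).
assert (G2 : d2 (p t) y = d_pressure Omega q1 q2 a b y 0 0 (0, 1, 0))
  by exact (d2_space rho _ _ Wp a b y Hy).
assert (G3 : d3 (p t) y = d_pressure Omega q1 q2 a b y 0 0 (0, 0, 1))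
  by exact (d3_space rho _ _ Wp a b y Hy).
assert (Hx : cylinder h X) by now apply rot_point_cylinder.
assert (S1 : d1 q2 X =
  (- (c1 (Phi X) * d1 (fun z => c1 (Phi z)) X
     + c2 (Phi X) * d2 (fun z => c1 (Phi z)) X
     + c3 (Phi X) * d3 (fun z => c1 (Phi z)) X))%C).
{ assert (S := f_equal c1 (Hself X Hx)).
  change (c1 (advect Phi Phi X)) with (c1 (Phi X) * d1 (fun z => c1 (Phi z)) X
     + c2 (Phi X) * d2 (fun z => c1 (Phi z)) X
     + c3 (Phi X) * d3 (fun z => c1 (Phi z)) X)%C in S.
  rewrite S. change (c1 (vopp (grad q2 X))) with (- d1 q2 X)%C. ring. }
assert (S2 : d2 q2 X =
  (- (c1 (Phi X) * d1 (fun z => c2 (Phi z)) X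
     + c2 (Phi X) * d2 (fun z => c2 (Phi z)) X
     + c3 (Phi X) * d3 (fun z => c2 (Phi z)) X))%C).
{ assert (S := f_equal c2 (Hself X Hx)).
  change (c2 (advect Phi Phi X)) with (c1 (Phi X) * d1 (fun z => c2 (Phi z)) X
     + c2 (Phi X) * d2 (fun z => c2 (Phi z)) X
     + c3 (Phi X) * d3 (fun z => c2 (Phi z)) X)%C in S.
  rewrite S. change (c2 (vopp (grad q2 X))) with (- d2 q2 X)%C. ring. }
assert (S3 : d3 q2 X =
  (- (c1 (Phi X) * d1 (fun z => c3 (Phi z)) X
     + c2 (Phi X) * d2 (fun z => c3 (Phi z)) X
     + c3 (Phi X) * d3 (fun z => c3 (Phi z)) X))%C).
{ assert (S := f_equal c3 (Hself X Hx)).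
  change (c3 (advect Phi Phi X)) with (c1 (Phi X) * d1 (fun z => c3 (Phi z)) X
     + c2 (Phi X) * d2 (fun z => c3 (Phi z)) X
     + c3 (Phi X) * d3 (fun z => c3 (Phi z)) X)%C in S.
  rewrite S. change (c3 (vopp (grad q2 X))) with (- d3 q2 X)%C. ring. }
assert (B1 : d1 q1 X = (- (RtoC kappa * Ci * c1 (Phi X)
  + - RtoC Omega * c2 (Phi X)))%C).
{ assert (B := f_equal c1 (Hcoriolis X Hx)).
  change (c1 (vopp (grad q1 X))) with (- d1 q1 X)%C in B.
  replace (d1 q1 X) with (- - d1 q1 X)%C by ring. rewrite <- B.
  unfold vadd, vscal, cross, e3, c1, c2, c3; cbn [fst snd]. ring. }
assert (B2 : d2 q1 X = (- (RtoC kappa * Ci * c2 (Phi X) + RtoC Omega * c1 (Phi X)))%C).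
{ assert (B := f_equal c2 (Hcoriolis X Hx)).
  change (c2 (vopp (grad q1 X))) with (- d2 q1 X)%C in B.
  replace (d2 q1 X) with (- - d2 q1 X)%C by ring. rewrite <- B.
  unfold vadd, vscal, cross, e3, c1, c2, c3; cbn [fst snd]. ring. }
assert (B3 : d3 q1 X = (- (RtoC kappa * Ci * c3 (Phi X) + 0))%C).
{ assert (B := f_equal c3 (Hcoriolis X Hx)).
  change (c3 (vopp (grad q1 X))) with (- d3 q1 X)%C in B.
  replace (d3 q1 X) with (- - d3 q1 X)%C by ring. rewrite <- B.
  unfold vadd, vscal, cross, e3, c1, c2, c3; cbn [fst snd]. ring. }
assert (V1 : c1 (V t y) = (- RtoC (Omega / 2) * RtoC (x2 y)
  + cis b * (RtoC (cos a) * c1 (Phi X) - RtoC (sin a) * c2 (Phi X)))%C)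
  by (unfold V, wave, vadd, vscal, cross, rot_vec, cvec_of_point, e3, c1, c2, c3;
      cbn [fst snd]; fold a b X; ring).
assert (V2 : c2 (V t y) = (RtoC (Omega / 2) * RtoC (x1 y)
  + cis b * (RtoC (sin a) * c1 (Phi X) + RtoC (cos a) * c2 (Phi X)))%C)
  by (unfold V, wave, vadd, vscal, cross, rot_vec, cvec_of_point, e3, c1, c2, c3;
      cbn [fst snd]; fold a b X; ring).
assert (V3 : c3 (V t y) = (cis b * c3 (Phi X))%C)
  by (unfold V, wave, vadd, vscal, cross, rot_vec, cvec_of_point, e3, c1, c2, c3;
      cbn [fst snd]; fold a b X; ring).
(* The Coriolis coefficient is twice the angular velocity Omega/2: one half comes from the turning
   of the components in time, the other from the mode advecting the solid rotation. *)
assert (EO : RtoC Omega = (2 * RtoC (Omega / 2))%C)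
  by (rewrite <- RtoC_mult; f_equal; field).
assert (EO2 : RtoC (Omega * Omega / 4) = (RtoC (Omega / 2) * RtoC (Omega / 2))%C)
  by (rewrite <- RtoC_mult; f_equal; field).
apply cvec_eq.
- change ((CDerive (fun s => c1 (V s y)) t
    + (c1 (V t y) * d1 (fun z => c1 (V t z)) y
       + c2 (V t y) * d2 (fun z => c1 (V t z)) y
       + c3 (V t y) * d3 (fun z => c1 (V t z)) y))%C = (- d1 (p t) y)%C).
  rewrite T1, D11, D12, D13, G1, V1, V2, V3.
  unfold d_wave1, d_pressure; cbv zeta.
  rewrite ?rot_total_d_e1, ?rot_total_d_e2, ?rot_total_d_e3, ?rot_total_d_time.
  fold X. rewrite ?B1, ?B2, ?B3, ?S1, ?S2, ?S3, ?EO, EO2.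
  change (x1 (1, 0, 0)) with 1. change (x2 (1, 0, 0)) with 0.
  change (x1 (0, 1, 0)) with 0. change (x2 (0, 1, 0)) with 1.
  change (x1 (0, 0, 1)) with 0. change (x2 (0, 0, 1)) with 0.
  change (x1 (0, 0, 0)) with 0. change (x2 (0, 0, 0)) with 0.
  (* The cofactor is e^{2ib} times the horizontal part of Phi . nabla applied to the first component
     of exp(aJ) Phi. Advecting velocity and gradient are both rotated, so their horizontal product
     acquires the factor cos^2 + sin^2. The other two components follow the same pattern. *)
  apply (Cminus_eq0_mult _
    (cis b * cis b * (c1 (Phi X) * (RtoC (cos a) * d1 (fun z => c1 (Phi z)) X -
      RtoC (sin a) * d1 (fun z => c2 (Phi z)) X) + c2 (Phi X) * (RtoC (cos a) * d2
      (fun z => c1 (Phi z)) X - RtoC (sin a) * d2 (fun z => c2 (Phi z)) X)))%C _ _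
      (C_cos2_sin2 a)).
  ring.
- change ((CDerive (fun s => c2 (V s y)) t
    + (c1 (V t y) * d1 (fun z => c2 (V t z)) y
       + c2 (V t y) * d2 (fun z => c2 (V t z)) y
       + c3 (V t y) * d3 (fun z => c2 (V t z)) y))%C = (- d2 (p t) y)%C).
  rewrite T2, D21, D22, D23, G2, V1, V2, V3.
  unfold d_wave2, d_pressure; cbv zeta.
  rewrite ?rot_total_d_e1, ?rot_total_d_e2, ?rot_total_d_e3, ?rot_total_d_time.
  fold X. rewrite ?B1, ?B2, ?B3, ?S1, ?S2, ?S3, ?EO, EO2.
  change (x1 (1, 0, 0)) with 1. change (x2 (1, 0, 0)) with 0.
  change (x1 (0, 1, 0)) with 0. change (x2 (0, 1, 0)) with 1.
  change (x1 (0, 0, 1)) with 0. change (x2 (0, 0, 1)) with 0.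
  change (x1 (0, 0, 0)) with 0. change (x2 (0, 0, 0)) with 0.
  apply (Cminus_eq0_mult _
    (cis b * cis b * (c1 (Phi X) * (RtoC (sin a) * d1 (fun z => c1 (Phi z)) X +
      RtoC (cos a) * d1 (fun z => c2 (Phi z)) X) + c2 (Phi X) * (RtoC (sin a) * d2
      (fun z => c1 (Phi z)) X + RtoC (cos a) * d2 (fun z => c2 (Phi z)) X)))%C _ _
      (C_cos2_sin2 a)).
  ring.
- change ((CDerive (fun s => c3 (V s y)) t
    + (c1 (V t y) * d1 (fun z => c3 (V t z)) y
       + c2 (V t y) * d2 (fun z => c3 (V t z)) y
       + c3 (V t y) * d3 (fun z => c3 (V t z)) y))%C = (- d3 (p t) y)%C).
  rewrite T3, D31, D32, D33, G3, V1, V2, V3.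
  unfold d_wave3, d_pressure; cbv zeta.
  rewrite ?rot_total_d_e1, ?rot_total_d_e2, ?rot_total_d_e3, ?rot_total_d_time.
  fold X. rewrite ?B1, ?B2, ?B3, ?S1, ?S2, ?S3, ?EO, EO2.
  change (x1 (1, 0, 0)) with 1. change (x2 (1, 0, 0)) with 0.
  change (x1 (0, 1, 0)) with 0. change (x2 (0, 1, 0)) with 1.
  change (x1 (0, 0, 1)) with 0. change (x2 (0, 0, 1)) with 0.
  change (x1 (0, 0, 0)) with 0. change (x2 (0, 0, 0)) with 0.
  apply (Cminus_eq0_mult _
    (cis b * cis b * (c1 (Phi X) * d1 (fun z => c3 (Phi z)) X + c2 (Phi X) * d2
      (fun z => c3 (Phi z)) X))%C _ _ (C_cos2_sin2 a)).
  ring.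
Qed.

Lemma wave_div t y : cylinder h y -> div (V t) y = RtoC 0.
Proof.
intros Hcyl.
assert (Hy := closed_tube_tube rho y Hrho (cylinder_closed_tube h y Hcyl)).
assert (W1 := wave1_C1 Omega rho Phi HPhi).
assert (W2 := wave2_C1 Omega rho Phi HPhi).
assert (W3 := wave3_C1 Omega rho Phi HPhi).
set (a := Omega / 2 * t). set (b := kappa * t). set (X := rot_point (- a) y).
assert (D11 : d1 (fun z => c1 (V t z)) y
  = d_wave1 Omega Phi a b y 0 0 (1, 0, 0))
  by exact (d1_space rho _ _ W1 a b y Hy).
assert (D22 : d2 (fun z => c2 (V t z)) y
  = d_wave2 Omega Phi a b y 0 0 (0, 1, 0))
  by exact (d2_space rho _ _ W2 a b y Hy).
assert (D33 : d3 (fun z => c3 (V t z)) y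
  = d_wave3 Phi a b y 0 0 (0, 0, 1))
  by exact (d3_space rho _ _ W3 a b y Hy).
assert (Hx : cylinder h X) by now apply rot_point_cylinder.
assert (H := Hdiv X Hx). unfold div in H. unfold div.
rewrite D11, D22, D33.
unfold d_wave1, d_wave2, d_wave3; cbv zeta.
rewrite ?rot_total_d_e1, ?rot_total_d_e2, ?rot_total_d_e3.
fold X.
change (x2 (1, 0, 0)) with 0. change (x1 (0, 1, 0)) with 0.
set (m11 := d1 (fun z => c1 (Phi z)) X) in *.
set (m12 := d2 (fun z => c1 (Phi z)) X) in *.
set (m21 := d1 (fun z => c2 (Phi z)) X) in *.
set (m22 := d2 (fun z => c2 (Phi z)) X) in *.
set (m33 := d3 (fun z => c3 (Phi z)) X) in *.
(* With M the horizontal Jacobian of [Phi] and R the rotation, the horizontal divergence is e^{ib}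
   tr(R M R^T) = e^{ib} (cos^2 + sin^2) (m11 + m22). *)
apply (Cminus_eq0_mult _ (cis b * (m11 + m22))%C _ _ (C_cos2_sin2 a)).
replace m33 with (m11 + m22 + m33 - m11 - m22)%C by ring. rewrite H. ring.
Qed.

Lemma rot_point_closed_tube a y : closed_tube y -> closed_tube (rot_point a y).
Proof. unfold closed_tube. now rewrite rot_point_norm. Qed.

Lemma wave_periodic t : periodic h (V t) /\ periodic h (p t).
Proof.
split; intros y Hy;
  assert (Hx := rot_point_closed_tube (- (Omega / 2 * t)) y Hy).
- unfold V, wave. rewrite rot_point_shift, (Hper _ Hx).
  f_equal. unfold vscal, cross, e3, cvec_of_point, x1, x2, x3, c1, c2, c3.
  cbn [fst snd]. f_equal. f_equal; ring.
- unfold p, wave_pressure. now rewrite rot_point_shift, (Hper1 _ Hx), (Hper2 _ Hx).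
Qed.

(** The normal turns with the point, so the rotated mode meets it as [Phi] does at the point turned
    back; the solid rotation is orthogonal to the horizontal radius. *)
Lemma wave_tangential t : tangential (V t).
Proof.
intros y Hy. set (a := Omega / 2 * t). set (X := rot_point (- a) y).
assert (Hx : lateral X) by (unfold lateral, X; now rewrite rot_point_norm).
assert (H := Htan X Hx).
unfold vdot, normal, radius in H |- *.
assert (E1 : x1 X = cos a * x1 y + sin a * x2 y)
  by (unfold X; rewrite rot_point_neg; reflexivity).
assert (E2 : x2 X = - sin a * x1 y + cos a * x2 y)
  by (unfold X; rewrite rot_point_neg; reflexivity).
unfold V, wave, vadd, vscal, cross, rot_vec, cvec_of_point, e3.
fold a X. unfold c1, c2, c3 in *. cbn [fst snd] in H |- *.
rewrite E1, E2 in H. unfold Rdiv in *. rewrite Rinv_1, ?Rmult_1_r in *.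
repeat rewrite ?RtoC_plus, ?RtoC_mult, ?RtoC_opp in H.
set (u1 := fst (fst (Phi X))) in *. set (u2 := snd (fst (Phi X))) in *.
apply (Cminus_eq0_mult _ (cis (kappa * t)) _ _ H). ring.
Qed.

(** The reduction shared by both kinds of modes: each has only to supply the potentials [q1] of the
    Coriolis balance and [q2] of the self-advection, besides regularity, periodicity, tangency and
    zero divergence. *)
Lemma rotating_wave_solution :
  quasiperiodic_T2 V /\ exists p' : R -> point -> C, Euler_solution h V p'.
Proof.
split; [exact wave_quasiperiodic |]. exists p. repeat split.
- exists rho. split; [exact Hrho |]. split; [split; [| split] |].
  + exact (C1_on_spacetime rho _ _ (wave1_C1 Omega rho Phi HPhi) (Omega / 2) kappa).
  + exact (C1_on_spacetime rho _ _ (wave2_C1 Omega rho Phi HPhi) (Omega / 2) kappa).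
  + exact (C1_on_spacetime rho _ _ (wave3_C1 Omega rho Phi HPhi) (Omega / 2) kappa).
  + exact (C1_on_spacetime rho _ _ (wave_pressure_C1 Omega rho q1 q2 Hq1 Hq2)
      (Omega / 2) kappa).
- exact wave_momentum.
- exact wave_div.
- apply wave_periodic.
- apply wave_periodic.
- exact wave_tangential.
Qed.

End Rotating_wave.

(** * Differentials of the potentials *)

Lemma total_d_e1 f y : total_d f y (1, 0, 0) = d1 f y.
Proof. unfold total_d, x1, x2, x3; cbn [fst snd]. ring. Qed.

Lemma total_d_e2 f y : total_d f y (0, 1, 0) = d2 f y.
Proof. unfold total_d, x1, x2, x3; cbn [fst snd]. ring. Qed.

Lemma total_d_e3 f y : total_d f y (0, 0, 1) = d3 f y.
Proof. unfold total_d, x1, x2, x3; cbn [fst snd]. ring. Qed.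

Lemma C1_on_continuous rho (f : point -> C) (y : R3) :
  C1_on (U := R3) (tube rho) f -> tube rho y ->
  continuous (U := C_R_NormedModule) f y.
Proof.
intros H Hy. exact (C1_diff_continuous _ _ _ _ (C1_on_total_d rho f H) Hy).
Qed.

Section Scaling.

Variables (rho : R) (k : C) (f : point -> C).
Hypothesis Hf : C1_on (U := R3) (tube rho) f.

Lemma C1_scaled :
  C1_diff (U := R3) (V := C_R_NormedModule) (tube rho) (fun y => (k * f y)%C)
    (fun y v => (k * total_d f y v)%C).
Proof.
eapply C1_diff_eq; cycle 2.
- exact (C1_cplx_mult _ _ _ _ _ (C1_diff_const (V := C_R_NormedModule) _ k)
    (C1_on_total_d rho f Hf)).
- reflexivity.
- intros y v. cbv beta. change (@zero C_R_NormedModule) with (RtoC 0). C_ring.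
Qed.

Lemma C1_on_scaled : C1_on (U := R3) (tube rho) (fun y => (k * f y)%C).
Proof. eexists. exact C1_scaled. Qed.

Lemma d1_scaled y : tube rho y -> d1 (fun z => k * f z)%C y = (k * d1 f y)%C.
Proof.
intros Hy. rewrite <- (total_d_e1 f). exact (d1_C1 _ _ _ C1_scaled y Hy).
Qed.

Lemma d2_scaled y : tube rho y -> d2 (fun z => k * f z)%C y = (k * d2 f y)%C.
Proof.
intros Hy. rewrite <- (total_d_e2 f). exact (d2_C1 _ _ _ C1_scaled y Hy).
Qed.

Lemma d3_scaled y : tube rho y -> d3 (fun z => k * f z)%C y = (k * d3 f y)%C.
Proof.
intros Hy. rewrite <- (total_d_e3 f). exact (d3_C1 _ _ _ C1_scaled y Hy).
Qed.

End Scaling.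

(** The weights cover both self-advection potentials: - Phi . Phi / 2 for curl eigenfunctions and -
    ((d1 f)^2 + (d2 f)^2 + mu f^2) / 2 for planar modes. *)
Lemma C1_sum_of_squares rho (k1 k2 k3 : C) (f1 f2 f3 : point -> C) :
  C1_on (U := R3) (tube rho) f1 -> C1_on (U := R3) (tube rho) f2 ->
  C1_on (U := R3) (tube rho) f3 ->
  C1_diff (U := R3) (V := C_R_NormedModule) (tube rho)
    (fun y => (k1 * (f1 y * f1 y) + k2 * (f2 y * f2 y) + k3 * (f3 y * f3 y))%C)
    (fun y v => (2 * (k1 * (f1 y * total_d f1 y v) + k2 * (f2 y * total_d f2 y v)
       + k3 * (f3 y * total_d f3 y v)))%C).
Proof.
intros H1 H2 H3.
assert (T1 := C1_on_total_d rho f1 H1). assert (T2 := C1_on_total_d rho f2 H2).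
assert (T3 := C1_on_total_d rho f3 H3).
assert (K := fun k => C1_diff_const (U := R3) (V := C_R_NormedModule) (tube rho) k).
eapply C1_diff_eq; cycle 2.
- exact (C1_cplx_plus _ _ _ _ _ (C1_cplx_plus _ _ _ _ _
   (C1_cplx_mult _ _ _ _ _ (K k1) (C1_cplx_mult _ _ _ _ _ T1 T1))
   (C1_cplx_mult _ _ _ _ _ (K k2) (C1_cplx_mult _ _ _ _ _ T2 T2)))
   (C1_cplx_mult _ _ _ _ _ (K k3) (C1_cplx_mult _ _ _ _ _ T3 T3))).
- reflexivity.
- intros y v. cbv beta. change (@zero C_R_NormedModule) with (RtoC 0). C_ring.
Qed.

(** * Beltrami modes *)

(** The arc cosine of a / r gives the angle up to sign, and the sign of [b] decides. *)
Lemma polar_coordinates a b : (a, b) <> (0, 0) ->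
  exists r theta, 0 < r /\ r ^ 2 = a ^ 2 + b ^ 2 /\
    a = r * cos theta /\ b = r * sin theta.
Proof.
intros H.
assert (P : 0 < a * a + b * b).
{ destruct (Req_dec a 0) as [-> |]; [| nra].
  destruct (Req_dec b 0) as [-> |]; [now destruct H | nra]. }
set (r := sqrt (a * a + b * b)).
assert (Hr : 0 < r) by now apply sqrt_lt_R0.
assert (Er : r * r = a * a + b * b) by (apply sqrt_sqrt; lra).
assert (Ha : -1 <= a / r <= 1).
{ assert (- r <= a <= r) by (split; nra).
  split; [apply Rmult_le_reg_r with r | apply Rmult_le_reg_r with r]; try assumption;
    unfold Rdiv; rewrite Rmult_assoc, Rinv_l; lra. }
assert (Es : r * sqrt (1 - (a / r)²) = Rabs b).
{ rewrite <- (sqrt_Rsqr r) at 1 by lra. rewrite <- sqrt_mult_alt by (unfold Rsqr; nra).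
  rewrite <- sqrt_Rsqr_abs. f_equal. unfold Rsqr. field_simplify; [nra | lra]. }
destruct (Rle_dec 0 b) as [Hb | Hb].
- exists r, (acos (a / r)). rewrite cos_acos, sin_acos, Es, Rabs_pos_eq by assumption.
  repeat split; [assumption | simpl; lra | field; lra].
- exists r, (- acos (a / r)).
  rewrite cos_neg, sin_neg, cos_acos, sin_acos by assumption.
  repeat split; [assumption | simpl; lra | field; lra |].
  rewrite Ropp_mult_distr_r_reverse, Es, Rabs_left; lra.
Qed.

(** Uniqueness of the limit from the right; it carries identities known for r > 0 to the axis. *)
Lemma continuous_zero_from_right (g : R -> C) :
  continuous (U := C_R_NormedModule) g 0 ->
  (forall s, 0 < s <= 1 -> g s = RtoC 0) -> g 0 = RtoC 0.
Proof.
intros Hg Hz.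
apply (filterlim_locally_unique (V := C_R_NormedModule) (F := at_right 0) g).
- eapply filterlim_filter_le_1; [| exact Hg]. apply filter_le_within.
- eapply filterlim_ext_loc; [| apply (filterlim_const (RtoC 0))].
  exists (mkposreal 1 Rlt_0_1). intros s Hs H0. symmetry. apply Hz.
  unfold ball in Hs; simpl in Hs. unfold AbsRing_ball, abs, minus, plus, opp in Hs.
  simpl in Hs. apply Rabs_def2 in Hs. lra.
Qed.

Lemma cis_0 : cis 0 = RtoC 1.
Proof. unfold cis. now rewrite cos_0, sin_0. Qed.

Section Curl_mode.

Variables (h rho : R) (n2 n3 : Z) (Phi : point -> cvec).
Hypothesis Hrho : radius < rho.
Hypothesis HPhi : C1_vec_on (U := R3) (tube rho) Phi.
Hypothesis Hsep : separated h n2 n3 Phi.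

Let k := alpha h * IZR n3.

(** Comparison with the slice z = 0 eliminates the radial profiles and the angular phase. *)
Lemma separated_off_axis r theta z : 0 < r <= radius ->
  Phi (r * cos theta, r * sin theta, z)
  = vscal (cis (k * z)) (Phi (r * cos theta, r * sin theta, 0)).
Proof.
intros Hr. destruct Hsep as (Fr & Ft & Fz & H).
rewrite (H r theta z Hr), (H r theta 0 Hr). fold k.
rewrite Rmult_0_r, cis_0. unfold vscal, c1, c2, c3; cbn [fst snd].
f_equal; [f_equal |]; ring.
Qed.

(** The axis is approached along the ray theta = 0 at fixed height, one scalar component at a
    time. *)
Lemma separated_axis (f : point -> C) z : C1_on (U := R3) (tube rho) f ->
  (forall r, 0 < r <= radius -> f (r, 0, z) = (cis (k * z) * f (r, 0, 0))%C) ->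
  f (0, 0, z) = (cis (k * z) * f (0, 0, 0))%C.
Proof.
intros Hf H.
assert (L : forall w, continuous (T := R_UniformSpace) (U := C_R_NormedModule)
   (fun s => f (s, 0, w)) 0).
{ intros w. apply (continuous_comp (V := R3) (fun s : R => (s, 0, w)) f).
  - apply (C1_diff_continuous (U := R_NormedModule) (V := R3) (fun _ => True)
      _ (fun _ v => (v, 0, 0))); [| exact I].
    apply (C1_diff_pair (U := R_NormedModule)
      (V := prod_NormedModule _ R_NormedModule R_NormedModule) (W := R_NormedModule)
      _ (fun s => (s, 0)) (fun _ => w) (fun _ v => (v, 0)) (fun _ _ => 0)).
    + apply (C1_diff_pair (U := R_NormedModule)
        (V := R_NormedModule) (W := R_NormedModule)
        _ (fun s => s) (fun _ => 0) (fun _ v => v) (fun _ _ => 0)).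
      * apply (C1_diff_linear (U := R_NormedModule) _ (fun s => s)), is_linear_id.
      * apply (C1_diff_const (V := R_NormedModule)).
    + apply (C1_diff_const (V := R_NormedModule)).
  - apply (C1_on_continuous rho); [exact Hf |].
    unfold tube, x1, x2, radius in *; cbn [fst snd]. nra. }
assert (Z : (f (0, 0, z) - cis (k * z) * f (0, 0, 0))%C = RtoC 0).
{ apply (continuous_zero_from_right
    (fun s => (f (s, 0, z) - cis (k * z) * f (s, 0, 0))%C)).
  - apply (continuous_minus (V := C_R_NormedModule)); [apply L |].
    apply (continuous_comp (V := C_R_NormedModule) (fun s => f (s, 0, 0))
      (fun w => cis (k * z) * w)%C); [apply L |].
    apply (C1_diff_continuous (U := C_R_NormedModule) (V := C_R_NormedModule)
      (fun _ => True) _ _ _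
      (C1_cplx_mult _ _ _ _ _
        (C1_diff_const (U := C_R_NormedModule) (V := C_R_NormedModule) _ (cis (k * z)))
        (C1_diff_linear (V := C_R_NormedModule) _ (fun w => w) is_linear_id)) I).
  - intros s Hs. rewrite (H s Hs). ring. }
replace (f (0, 0, z)) with
  ((f (0, 0, z) - cis (k * z) * f (0, 0, 0)) + cis (k * z) * f (0, 0, 0))%C by ring.
rewrite Z. ring.
Qed.

Lemma separated_vertical y : closed_tube y ->
  Phi y = vscal (cis (k * x3 y)) (Phi (x1 y, x2 y, 0)).
Proof.
destruct y as [[a b] z]. unfold closed_tube, x1, x2, x3; cbn [fst snd]. intros Hy.
destruct (Req_dec (a ^ 2 + b ^ 2) 0) as [E | E].
- assert (a = 0) by nra. assert (b = 0) by nra. subst a b.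
  destruct HPhi as (H1 & H2 & H3).
  assert (A : forall r, 0 < r <= radius ->
    Phi (r, 0, z) = vscal (cis (k * z)) (Phi (r, 0, 0))).
  { intros r Hr. generalize (separated_off_axis r 0 z Hr).
    now rewrite cos_0, sin_0, Rmult_1_r, Rmult_0_r. }
  apply cvec_eq.
  + apply (separated_axis _ z H1). intros r Hr. now rewrite (A r Hr).
  + apply (separated_axis _ z H2). intros r Hr. now rewrite (A r Hr).
  + apply (separated_axis _ z H3). intros r Hr. now rewrite (A r Hr).
- destruct (polar_coordinates a b) as (r & theta & Hr & Er & -> & ->).
  { intros Z. injection Z as -> ->. apply E. ring. }
  apply separated_off_axis. split; [exact Hr |]. unfold radius in *. nra.
Qed.

Lemma separated_d3 (f : point -> C) y :
  (forall z, closed_tube z -> f z = (cis (k * x3 z) * f (x1 z, x2 z, 0%R))%C) ->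
  closed_tube y -> d3 f y = (RtoC k * Ci * f y)%C.
Proof.
intros H Hy. unfold d3.
(* [closed_tube] does not involve the height, so [Hy] serves for the whole vertical line through
   [y]. *)
assert (G := fun s => H (x1 y, x2 y, s) Hy). cbn [fst snd] in G.
unfold CDerive.
rewrite (Derive_ext (fun s => Re (f (x1 y, x2 y, s))) _ _ (fun s => f_equal Re (G s))).
rewrite (Derive_ext (fun s => Im (f (x1 y, x2 y, s))) _ _ (fun s => f_equal Im (G s))).
set (w := f (x1 y, x2 y, 0)) in *.
assert (HC := C1_cplx_mult (U := R_NormedModule) (fun _ => True) _ _ _ _
  (C1_cplx_cis _ _ _ (C1_diff_linear (U := R_NormedModule) (V := R_NormedModule) _ _
     (is_linear_scal_r k Rmult_comm)))
  (C1_diff_const (V := C_R_NormedModule) _ w)).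
assert (D := CDerive_line _ _ _ (fun s => s) (x3 y) 1 HC I). cbv beta in D.
transitivity (CDerive (fun s => cis (k * s) * w)%C (x3 y)); [reflexivity |].
etransitivity; [apply D |].
- intros u. module_ring.
- change (@zero C_R_NormedModule) with (RtoC 0).
  change (scal k 1) with (k * 1). rewrite Rmult_1_r.
  change (scal k (x3 y)) with (k * x3 y).
  rewrite (H y Hy). fold w. ring.
Qed.

End Curl_mode.

Lemma curl_mode_solution (Omega h : R) (pm : bool) (n2 n3 : Z) (lam : R)
    (Phi : point -> cvec) :
  curl_mode h pm n2 n3 lam Phi ->
  quasiperiodic_T2 (V_field Omega h pm n3 lam Phi) /\
  exists p : R -> point -> C, Euler_solution h (V_field Omega h pm n3 lam Phi) p.
Proof.
intros (Hlam & (rho & Hrho & HPhi) & _ & Hcurl & Hdiv & Htan & Hper & Hsep).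
destruct HPhi as (H1 & H2 & H3).
change (NormedModule.sort R_AbsRing R3) with point in H1, H2, H3.
set (L := sgn pm * Rabs lam).
assert (HL : L <> 0).
{ apply Rmult_integral_contrapositive_currified; [| now apply Rabs_no_R0].
  unfold sgn. destruct pm; lra. }
set (k := alpha h * IZR n3).
set (m := Omega / L).
set (kappa := sgn pm * (IZR n3 / Rabs lam) * alpha h * Omega).
(* A sign is its own inverse, so the exponent of [V_field] is alpha n3 Omega / L with L the signed
   eigenvalue. *)
assert (Ek : kappa = m * k).
{ unfold kappa, m, k, L. assert (Rabs lam <> 0) by now apply Rabs_no_R0.
  unfold sgn. destruct pm; field; auto. }
assert (EO : Omega = m * L) by (unfold m; field; exact HL).
(* [e3 x curl Phi = grad Phi_3 - d3 Phi] turns the Coriolis force into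
   [m grad Phi_3 - i kappa Phi]. *)
set (q1 := fun y => (RtoC (- m) * c3 (Phi y))%C).
set (q2 := fun y => (RtoC (- / 2) * (c1 (Phi y) * c1 (Phi y))
  + RtoC (- / 2) * (c2 (Phi y) * c2 (Phi y))
  + RtoC (- / 2) * (c3 (Phi y) * c3 (Phi y)))%C).
assert (Q2 := C1_sum_of_squares rho (RtoC (- / 2)) (RtoC (- / 2)) (RtoC (- / 2))
  _ _ _ H1 H2 H3).
assert (Etwo : (2 * RtoC (- / 2))%C = (- RtoC 1)%C)
  by (rewrite <- RtoC_mult, <- RtoC_opp; f_equal; field).
assert (Sep := separated_vertical h rho n2 n3 Phi Hrho (conj H1 (conj H2 H3)) Hsep).
fold k in Sep.
assert (Hcyl : forall y, cylinder h y ->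
  d3 (fun z => c1 (Phi z)) y = (RtoC k * Ci * c1 (Phi y))%C /\
  d3 (fun z => c2 (Phi z)) y = (RtoC k * Ci * c2 (Phi y))%C /\
  d3 (fun z => c3 (Phi z)) y = (RtoC k * Ci * c3 (Phi y))%C).
{ intros y Hy. apply cylinder_closed_tube in Hy.
  split; [| split]; apply (separated_d3 h n3); try exact Hy;
    intros z Hz; now rewrite (Sep z Hz) at 1. }
assert (HC : forall y, cylinder h y ->
  d2 (fun z => c3 (Phi z)) y
    = (d3 (fun z => c2 (Phi z)) y + RtoC L * c1 (Phi y))%C /\
  d1 (fun z => c3 (Phi z)) y
    = (d3 (fun z => c1 (Phi z)) y - RtoC L * c2 (Phi y))%C /\
  d1 (fun z => c2 (Phi z)) y
    = (d2 (fun z => c1 (Phi z)) y + RtoC L * c3 (Phi y))%C).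
{ intros y Hy. assert (E := Hcurl y Hy). fold L in E.
  assert (E1 := f_equal c1 E). assert (E2 := f_equal c2 E). assert (E3 := f_equal c3 E).
  change ((d2 (fun z => c3 (Phi z)) y - d3 (fun z => c2 (Phi z)) y)%C
    = (RtoC L * c1 (Phi y))%C) in E1.
  change ((d3 (fun z => c1 (Phi z)) y - d1 (fun z => c3 (Phi z)) y)%C
    = (RtoC L * c2 (Phi y))%C) in E2.
  change ((d1 (fun z => c2 (Phi z)) y - d2 (fun z => c1 (Phi z)) y)%C
    = (RtoC L * c3 (Phi y))%C) in E3.
  rewrite <- E1, <- E2, <- E3. repeat split; ring. }
apply (rotating_wave_solution Omega h kappa rho Phi q1 q2 Hrho (conj H1 (conj H2 H3))).
- exact (C1_on_scaled rho _ _ H3).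
- eexists. exact Q2.
- exact Htan.
- exact Hper.
- intros y Hy. unfold q1. now rewrite Hper.
- intros y Hy. unfold q2. now rewrite Hper.
- exact Hdiv.
- intros y Hy.
  assert (Ht := closed_tube_tube rho y Hrho (cylinder_closed_tube h y Hy)).
  destruct (HC y Hy) as (C32 & C31 & C21).
  assert (G1 : d1 q2 y = _) by exact (d1_C1 _ _ _ Q2 y Ht).
  assert (G2 : d2 q2 y = _) by exact (d2_C1 _ _ _ Q2 y Ht).
  assert (G3 : d3 q2 y = _) by exact (d3_C1 _ _ _ Q2 y Ht).
  cbv beta in G1, G2, G3.
  rewrite !total_d_e1 in G1. rewrite !total_d_e2 in G2. rewrite !total_d_e3 in G3.
  assert (F : forall a b c, (2 * (RtoC (- / 2) * a + RtoC (- / 2) * b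
     + RtoC (- / 2) * c) = - (a + b + c))%C).
  { intros a b c. transitivity ((2 * RtoC (- / 2)) * (a + b + c))%C; [ring |].
    rewrite Etwo. ring. }
  rewrite F in G1, G2, G3.
  (* Componentwise (Phi . nabla) Phi = grad (Phi . Phi / 2) + curl Phi x Phi, where the last term
     vanishes because curl Phi is a multiple of Phi; the identity is bilinear and so holds for
     complex fields. *)
  apply cvec_eq.
  + change (c1 (Phi y) * d1 (fun z => c1 (Phi z)) y
      + c2 (Phi y) * d2 (fun z => c1 (Phi z)) y
      + c3 (Phi y) * d3 (fun z => c1 (Phi z)) y = - d1 q2 y)%C.
    rewrite G1, C31, C21. ring.
  + change (c1 (Phi y) * d1 (fun z => c2 (Phi z)) y
      + c2 (Phi y) * d2 (fun z => c2 (Phi z)) y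
      + c3 (Phi y) * d3 (fun z => c2 (Phi z)) y = - d2 q2 y)%C.
    rewrite G2, C32, C21. ring.
  + change (c1 (Phi y) * d1 (fun z => c3 (Phi z)) y
      + c2 (Phi y) * d2 (fun z => c3 (Phi z)) y
      + c3 (Phi y) * d3 (fun z => c3 (Phi z)) y = - d3 q2 y)%C.
    rewrite G3, C31, C32. ring.
- intros y Hy.
  assert (Ht := closed_tube_tube rho y Hrho (cylinder_closed_tube h y Hy)).
  destruct (HC y Hy) as (C32 & C31 & _). destruct (Hcyl y Hy) as (K1 & K2 & K3).
  rewrite K1 in C31. rewrite K2 in C32.
  rewrite Ek, EO, !RtoC_mult.
  apply cvec_eq.
  + change (RtoC m * RtoC k * Ci * c1 (Phi y)
      + RtoC m * RtoC L * (0 * c3 (Phi y) - 1 * c2 (Phi y))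
      = - d1 q1 y)%C.
    unfold q1. rewrite (d1_scaled rho _ _ H3 y Ht), C31, RtoC_opp. ring.
  + change (RtoC m * RtoC k * Ci * c2 (Phi y)
      + RtoC m * RtoC L * (1 * c1 (Phi y) - 0 * c3 (Phi y))
      = - d2 q1 y)%C.
    unfold q1. rewrite (d2_scaled rho _ _ H3 y Ht), C32, RtoC_opp. ring.
  + change (RtoC m * RtoC k * Ci * c3 (Phi y)
      + RtoC m * RtoC L * (0 * c2 (Phi y) - 0 * c1 (Phi y))
      = - d3 q1 y)%C.
    unfold q1. rewrite (d3_scaled rho _ _ H3 y Ht), K3, RtoC_opp. ring.
Qed.

(** * Planar modes *)

Section Schwarz_real.

Variables (rho : R) (T : C -> R) (f : point -> C).
Hypothesis T_linear : is_linear (U := C_R_NormedModule) (V := R_NormedModule) T.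
Hypothesis T_CDerive : forall g x, T (CDerive g x) = Derive (fun s => T (g s)) x.
Hypothesis Hf : C2_on (tube rho) f.

(** [T] stands for [Re] or [Im]: Schwarz's theorem concerns real functions and is applied to both
    parts through one argument. *)
Lemma C1_real_part (g : point -> C) : C1_on (U := R3) (tube rho) g ->
  C1_diff (U := R3) (V := R_NormedModule) (tube rho) (fun y => T (g y))
    (fun y v => T (total_d g y v)).
Proof.
intros Hg y Hy. destruct (C1_on_total_d rho g Hg y Hy) as [h1 h2]. split.
- apply (filterdiff_comp' (U := R3) (W := R_NormedModule) g T _ _ _ h1).
  now apply filterdiff_linear.
- intros v. apply (continuous_comp (fun y => total_d g y v) T); [apply h2 |].
  exact (linear_cont (U := C_R_NormedModule) (V := R_NormedModule) T _ T_linear).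
Qed.

Lemma ex_derive_x1 (g : point -> C) a b z : C1_on (U := R3) (tube rho) g ->
  tube rho (a, b, z) -> ex_derive (fun s => T (g (s, b, z))) a.
Proof.
intros Hg Hy. eexists.
apply (is_derive_line (U := R3) (tube rho) (fun y => T (g y)) _
  (fun s => (s, b, z)) a (1, 0, 0) (C1_real_part g Hg) Hy).
intros u. module_ring.
Qed.

Lemma ex_derive_x2 (g : point -> C) a b z : C1_on (U := R3) (tube rho) g ->
  tube rho (a, b, z) -> ex_derive (fun s => T (g (a, s, z))) b.
Proof.
intros Hg Hy. eexists.
apply (is_derive_line (U := R3) (tube rho) (fun y => T (g y)) _
  (fun s => (a, s, z)) b (0, 1, 0) (C1_real_part g Hg) Hy).
intros u. module_ring.
Qed.

Lemma continuity_2d_slice (g : point -> C) a b z :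
  continuous (T := R3) (U := C_R_NormedModule) g (a, b, z) ->
  continuity_2d_pt (fun u v => T (g (u, v, z))) a b.
Proof.
intros Hg. apply continuity_2d_pt_filterlim.
apply (continuous_comp (U := prod_UniformSpace R_UniformSpace R_UniformSpace)
  (V := R3) (W := R_UniformSpace)
  (fun w : R * R => (fst w, snd w, z)) (fun y => T (g y)) (a, b)).
- intros P [e He]. exists e. intros [u v] [Hu Hv]. apply He.
  split; [split; assumption | apply ball_center].
- apply (continuous_comp (V := C_R_NormedModule) g T); [exact Hg |].
  exact (linear_cont (U := C_R_NormedModule) (V := R_NormedModule) T _ T_linear).
Qed.

(** On a horizontal slice, C^1 regularity of [d1 f] and [d2 f] supplies the second derivatives near
    the point and their continuity at it. *)
Lemma mixed_partials_part (y : point) : tube rho y ->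
  T (d1 (d2 f) y) = T (d2 (d1 f) y).
Proof.
destruct Hf as (Hf0 & Hf1 & Hf2 & _). destruct y as [[a b] z]. intros Hy.
assert (E1 : forall u v, T (d1 f (u, v, z)) = Derive (fun t => T (f (t, v, z))) u)
  by (intros; apply T_CDerive).
assert (E2 : forall u v, T (d2 f (u, v, z)) = Derive (fun t => T (f (u, t, z))) v)
  by (intros; apply T_CDerive).
assert (E12 : forall u v, T (d1 (d2 f) (u, v, z))
  = Derive (fun s => Derive (fun t => T (f (s, t, z))) v) u).
{ intros u v. unfold d1 at 1. rewrite T_CDerive. apply Derive_ext. intros s. apply E2. }
assert (E21 : forall u v, T (d2 (d1 f) (u, v, z))
  = Derive (fun s => Derive (fun t => T (f (t, s, z))) u) v).
{ intros u v. unfold d2 at 1. rewrite T_CDerive. apply Derive_ext. intros s. apply E1. }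
rewrite E12, E21.
apply (Schwarz (fun u v => T (f (u, v, z)))).
- apply locally_2d_locally.
  destruct (tube_open rho (a, b, z) Hy) as [e He].
  exists e. intros [u v] [Hu Hv]. cbn [fst snd].
  assert (Ht : tube rho (u, v, z)).
  { apply He. split; [split; assumption | apply ball_center]. }
  split; [| split; [| split]].
  + now apply ex_derive_x1.
  + now apply ex_derive_x2.
  + eapply ex_derive_ext; [| exact (ex_derive_x1 _ u v z Hf2 Ht)].
    intros t. apply E2.
  + eapply ex_derive_ext; [| exact (ex_derive_x2 _ u v z Hf1 Ht)].
    intros t. apply E1.
- apply (continuity_2d_pt_ext (fun u v => T (d1 (d2 f) (u, v, z)))); [exact E12 |].
  apply continuity_2d_slice. exact (proj1 (C1_on_continuous_d rho (d2 f) _ Hf2 Hy)).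
- apply (continuity_2d_pt_ext (fun u v => T (d2 (d1 f) (u, v, z)))); [exact E21 |].
  apply continuity_2d_slice.
  exact (proj1 (proj2 (C1_on_continuous_d rho (d1 f) _ Hf1 Hy))).
Qed.

End Schwarz_real.

Lemma mixed_partials rho f (y : point) : C2_on (tube rho) f -> tube rho y ->
  d1 (d2 f) y = d2 (d1 f) y.
Proof.
intros Hf Hy. apply injective_projections.
- apply (mixed_partials_part rho Re); auto. apply is_linear_fst.
- apply (mixed_partials_part rho Im); auto. apply is_linear_snd.
Qed.

Lemma CDerive_const c x : CDerive (fun _ => c) x = RtoC 0.
Proof. unfold CDerive. now rewrite !Derive_const. Qed.

Section Planar_mode.

Variables (phi : R * R -> C) (rho mu : R).
Let f (y : point) : C := phi (x1 y, x2 y).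
Hypothesis Hrho : radius < rho.
Hypothesis Hf : C2_on (tube rho) f.

(** For [f], its horizontal partials and the potential built from them, independence of the height
    holds by conversion, so [reflexivity] discharges the premise. *)
Lemma d3_planar g y : (forall z, g z = g (x1 z, x2 z, 0)) -> d3 g y = RtoC 0.
Proof.
intros H. unfold d3, CDerive.
rewrite (Derive_ext (fun s => Re (g (x1 y, x2 y, s))) _ _ (fun s => f_equal Re (H _))).
rewrite (Derive_ext (fun s => Im (g (x1 y, x2 y, s))) _ _ (fun s => f_equal Im (H _))).
cbn [x1 x2 fst snd]. now rewrite !Derive_const.
Qed.

Definition planar_field (y : point) : cvec := (d2 f y, (- d1 f y)%C, f y).

Lemma planar_curl y :
  vadd (curl (fun z => vscal (f z) e3) y) (vscal (f y) e3) = planar_field y.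
Proof.
assert (Z1 : d1 (fun _ => RtoC 0) y = RtoC 0) by apply CDerive_const.
assert (Z2 : d2 (fun _ => RtoC 0) y = RtoC 0) by apply CDerive_const.
assert (Z3 : d3 (fun _ => RtoC 0) y = RtoC 0) by apply CDerive_const.
assert (E : forall z, (f z * RtoC 1)%C = f z) by (intros; ring).
assert (E0 : forall z, (f z * RtoC 0)%C = RtoC 0) by (intros; ring).
assert (F1 : (fun z => c3 (vscal (f z) e3)) = f)
  by (apply functional_extensionality; intros; apply E).
assert (F2 : (fun z => c2 (vscal (f z) e3)) = fun _ => RtoC 0)
  by (apply functional_extensionality; intros; apply E0).
assert (F3 : (fun z => c1 (vscal (f z) e3)) = fun _ => RtoC 0)
  by (apply functional_extensionality; intros; apply E0).
unfold curl. rewrite F1, F2, F3, Z1, Z2, Z3. unfold planar_field.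
unfold vadd, vscal, e3, c1, c2, c3. cbn [fst snd].
f_equal; [f_equal |]; ring.
Qed.

(* [f] vanishes along the circle through [y], so its angular derivative does. *)
Lemma planar_tangential :
  (forall y, lateral y -> f y = RtoC 0) -> tangential planar_field.
Proof.
intros H0 y Hy.
destruct Hf as (Hf0 & _).
assert (Ht : tube rho y).
{ apply closed_tube_tube; [exact Hrho |]. unfold closed_tube. rewrite Hy. lra. }
(* Unit speed in the first phase and rest in the second move the point around its circle; at time 0
   the derivative is y2 d1 f - y1 d2 f, which is minus the normal component. *)
assert (D := CDerive_time rho _ _ (corotating_C1 rho f Hf0) 1 0 0 y Ht).
unfold phase_a, phase_b, place in D; cbn [fst snd] in D.
rewrite rot_total_d_time, Rmult_0_r, cos_0, sin_0 in D.
assert (Ey : rot_point (- 0) y = y).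
{ rewrite rot_point_neg, cos_0, sin_0. destruct y as [[a b] c].
  unfold x1, x2, x3; cbn [fst snd]. f_equal. f_equal; ring. }
rewrite Ey in D.
assert (Z : CDerive (fun s => f (rot_point (- (1 * s)) y)) 0 = RtoC 0).
{ replace (fun s => f (rot_point (- (1 * s)) y)) with (fun _ : R => RtoC 0).
  - apply CDerive_const.
  - apply functional_extensionality. intros s. symmetry. apply H0.
    unfold lateral. now rewrite rot_point_norm. }
rewrite Z in D.
unfold vdot, normal, planar_field, radius, c1, c2, c3. cbn [fst snd].
rewrite !Rdiv_1_r. apply (Cminus_eq0_mult _ (- (1))%C _ _ (eq_sym D)). ring.
Qed.

Lemma planar_div y : tube rho y -> div planar_field y = RtoC 0.
Proof.
intros Hy.
assert (M := mixed_partials rho f y Hf Hy). destruct Hf as (_ & Hf1 & _).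
change ((d1 (d2 f) y + d2 (fun z => - d1 f z) y + d3 f y)%C = RtoC 0).
assert (N : d2 (fun z => - d1 f z)%C y = (- d2 (d1 f) y)%C).
{ exact (eq_trans
    (d2_C1 _ _ _ (C1_cplx_opp _ _ _ (C1_on_total_d rho _ Hf1)) y Hy)
    (f_equal Copp (total_d_e2 (d1 f) y))). }
rewrite N, M, d3_planar by reflexivity. ring.
Qed.

Lemma planar_mode_solution Omega h pm lam :
  (forall y, cylinder h y -> (- laplacian f y)%C = (RtoC mu * f y)%C) ->
  (forall y, lateral y -> f y = RtoC 0) ->
  quasiperiodic_T2 (V_field Omega h pm 0 lam planar_field) /\
  exists p : R -> point -> C,
    Euler_solution h (V_field Omega h pm 0 lam planar_field) p.
Proof.
intros Hlap H0.
set (kappa := sgn pm * (IZR 0 / Rabs lam) * alpha h * Omega).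
(* The factor [IZR 0] makes the exponent vanish for every [lam], including [lam = 0], where the
   inverse is a default value. *)
assert (Ek : kappa = 0) by (unfold kappa, Rdiv; ring).
set (q1 := fun y => (RtoC (- Omega) * f y)%C).
set (q2 := fun y => (RtoC (- / 2) * (d1 f y * d1 f y)
  + RtoC (- / 2) * (d2 f y * d2 f y) + RtoC (- / 2 * mu) * (f y * f y))%C).
destruct Hf as (Hf0 & Hf1 & Hf2 & _).
assert (Q2 := C1_sum_of_squares rho (RtoC (- / 2)) (RtoC (- / 2)) (RtoC (- / 2 * mu))
  _ _ _ Hf1 Hf2 Hf0).
assert (Etwo : (2 * RtoC (- / 2))%C = (- RtoC 1)%C)
  by (rewrite <- RtoC_mult, <- RtoC_opp; f_equal; field).
assert (N := C1_cplx_opp _ _ _ (C1_on_total_d rho _ Hf1)).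
apply (rotating_wave_solution Omega h kappa rho planar_field q1 q2 Hrho).
- split; [exact Hf2 | split; [| exact Hf0]]. eexists. exact N.
- exact (C1_on_scaled rho _ _ Hf0).
- eexists. exact Q2.
- now apply planar_tangential.
- intros y Hy. reflexivity.
- intros y Hy. reflexivity.
- intros y Hy. reflexivity.
- intros y Hy. apply planar_div. apply closed_tube_tube; [exact Hrho |].
  now apply (cylinder_closed_tube h).
- intros y Hy.
  assert (Ht := closed_tube_tube rho y Hrho (cylinder_closed_tube h y Hy)).
  assert (G1 : d1 q2 y = _) by exact (d1_C1 _ _ _ Q2 y Ht).
  assert (G2 : d2 q2 y = _) by exact (d2_C1 _ _ _ Q2 y Ht).
  cbv beta in G1, G2.
  rewrite !total_d_e1 in G1. rewrite !total_d_e2 in G2.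
  assert (F : forall a b c, (2 * (RtoC (- / 2) * a + RtoC (- / 2) * b
     + RtoC (- / 2 * mu) * c) = - (a + b + RtoC mu * c))%C).
  { intros a b c. rewrite RtoC_mult.
    transitivity ((2 * RtoC (- / 2)) * (a + b + RtoC mu * c))%C; [ring |].
    rewrite Etwo. ring. }
  rewrite F in G1, G2.
  assert (L := Hlap y Hy). unfold laplacian in L.
  rewrite (d3_planar (d3 f)) in L
    by (intros z; rewrite !(d3_planar f) by reflexivity; reflexivity).
  assert (Lf : (RtoC mu * f y)%C = (- (d1 (d1 f) y + d2 (d2 f) y))%C)
    by (rewrite <- L; ring).
  assert (N1 : d1 (fun z => - d1 f z)%C y = (- d1 (d1 f) y)%C)
    by exact (eq_trans (d1_C1 _ _ _ N y Ht) (f_equal Copp (total_d_e1 (d1 f) y))).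
  assert (N2 : d2 (fun z => - d1 f z)%C y = (- d2 (d1 f) y)%C)
    by exact (eq_trans (d2_C1 _ _ _ N y Ht) (f_equal Copp (total_d_e2 (d1 f) y))).
  apply cvec_eq.
  + change (d2 f y * d1 (d2 f) y + - d1 f y * d2 (d2 f) y + f y * d3 (d2 f) y
      = - d1 q2 y)%C.
    rewrite G1, (d3_planar (d2 f)) by reflexivity.
    (* The eigenvalue equation turns - d1 f d2 d2 f into d1 f (d1 d1 f + mu f), which completes the
       derivative of half of (d1 f)^2 + (d2 f)^2 + mu f^2. *)
    transitivity (d1 f y * d1 (d1 f) y + d2 f y * d1 (d2 f) y
      + d1 f y * (RtoC mu * f y))%C; [rewrite Lf |]; ring.
  + change (d2 f y * d1 (fun z => - d1 f z) y + - d1 f y * d2 (fun z => - d1 f z) y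
      + f y * d3 (fun z => - d1 f z) y = - d2 q2 y)%C.
    rewrite G2, N1, N2, (d3_planar (fun z => - d1 f z)%C) by reflexivity.
    transitivity (d1 f y * d2 (d1 f) y + d2 f y * d2 (d2 f) y
      + d2 f y * (RtoC mu * f y))%C; [rewrite Lf |]; ring.
  + change (d2 f y * d1 f y + - d1 f y * d2 f y + f y * d3 f y = - d3 q2 y)%C.
    rewrite (d3_planar q2), (d3_planar f) by reflexivity. ring.
- intros y Hy.
  assert (Ht := closed_tube_tube rho y Hrho (cylinder_closed_tube h y Hy)).
  rewrite Ek. apply cvec_eq.
  + change (RtoC 0 * Ci * d2 f y + RtoC Omega * (0 * f y - 1 * - d1 f y)
      = - d1 q1 y)%C.
    unfold q1. rewrite (d1_scaled rho _ _ Hf0 y Ht), RtoC_opp. ring.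
  + change (RtoC 0 * Ci * - d1 f y + RtoC Omega * (1 * d2 f y - 0 * f y)
      = - d2 q1 y)%C.
    unfold q1. rewrite (d2_scaled rho _ _ Hf0 y Ht), RtoC_opp. ring.
  + change (RtoC 0 * Ci * f y + RtoC Omega * (0 * - d1 f y - 0 * d2 f y)
      = - d3 q1 y)%C.
    unfold q1. rewrite (d3_scaled rho _ _ Hf0 y Ht), d3_planar by reflexivity. ring.
Qed.

End Planar_mode.

Theorem lemma2p3 (Omega h : R) (pm : bool) (n2 n3 : Z) (lam : R)
    (Phi : point -> cvec) (hh : 0 < h) (hPhi : mode h pm n2 n3 lam Phi) :
  quasiperiodic_T2 (V_field Omega h pm n3 lam Phi) /\
  exists p : R -> point -> C,
    Euler_solution h (V_field Omega h pm n3 lam Phi) p.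
Proof.
destruct hPhi as [[_ H] | [-> (phi & mu & (rho & Hrho & Hf) & _ & Hlap & H0 & HPhi)]].
- exact (curl_mode_solution Omega h pm n2 n3 lam Phi H).
(* The mode is prescribed at every point of space, so it can be replaced as a function, also under
   the derivatives in [Euler_solution]. *)
- assert (E : Phi = planar_field phi).
  { apply functional_extensionality. intros y. rewrite HPhi. apply planar_curl. }
  rewrite E. exact (planar_mode_solution phi rho mu Hrho Hf Omega h pm lam Hlap H0).
Qed.
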